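(* Let $X$ be a curve whose function field $F$ is a cyclic extension of degree $p^n$ of the rational function field $k(x)$ in which every ramified place is totally ramified. For $1\le i\le s$, the gap sequence at the ramified point $P_i$ lying over the place $(x-\alpha_i)$ of $k(x)$ is $$\mathcal{G}(P_i)=\left\{\nu^{(k)}p^n+\rho_i^{(k)}+1 : 0\le k\le p^n-2,\ 0\le\nu^{(k)}\le\Gamma_k-2\right\},$$ where $\Gamma_k$ are the Boseck invariants associated to the extension $F/k(x)$.
   Context: The constant field (also denoted $k$ in $k(x)$) is algebraically closed of characteristic $p>0$; $X$ is a projective nonsingular curve of genus $\ge 2$. The places of $k(x)$ ramified in $F$ are $(x-\alpha_1),\ldots,(x-\alpha_s)$ (all finite). There is a unique tower $k(x)=L_0\subset L_1\subset\cdots\subset L_n=F$ with $[L_j:L_{j-1}]=p$, and generators are chosen in standard form: $L_j=L_{j-1}(y_j)$, $y_j^p-y_j=B_j\in L_{j-1}$, $\mathrm{div}(B_j)=A-\sum_i\lambda_{i,j}P_{i,j-1}$ with $A$ effective and prime to the pole divisor of $B_j$, $P_{i,j}$ the place of $L_j$ above $(x-\alpha_i)$, and $\lambda_{i,j}=-v_{P_{i,j-1}}(B_j)=-v_{P_{i,j}}(y_j)$ zero or a positive integer prime to $p$. Let $\delta_i$ be the different exponent of $P_i=P_{i,n}$ over $(x-\alpha_i)$. For an integer $0\le k\le p^n-1$ with $p$-adic expansion $k=a_1^{(k)}+a_2^{(k)}p+\cdots+a_n^{(k)}p^{n-1}$ set $\nu_{ik}=\left\lfloor \frac{\delta_i-\sum_{j=1}^n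 a_j^{(k)}\lambda_{i,j}p^{n-j}}{p^n}\right\rfloor$, $\ \Gamma_k=\sum_{i=1}^s\nu_{ik}$ (the Boseck invariants), and $\rho_i^{(k)}=\big(\delta_i-\sum_{j=1}^n a_j^{(k)}\lambda_{i,j}p^{n-j}\big)-\nu_{ik}p^n$. $\mathcal{G}(P_i)$ is the set of gaps at $P_i$, i.e. positive integers $a$ such that no function on $X$ has pole divisor $aP_i$. *)

(* Defs.v *)
From mathcomp Require Export all_boot all_order all_algebra all_fingroup
  all_solvable all_field.
From mathcomp Require Export finmap boolp classical_sets.

Set Implicit Arguments.
Unset Strict Implicit.
Unset Printing Implicit Defensive.

Import Order.TTheory GRing.Theory Num.Theory.

Local Open Scope ring_scope.

(* A function field over k is a finite extension F of k(x); k(x) itself is the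
   subfield 1 of F.  All places of intermediate fields k(x) <= E <= F are
   carried by functions F -> int, so that no subtype of F is needed. *)
Section FunctionField.

Variables (k : closedFieldType) (F : splittingFieldType {fraction {poly k}}).

Definition poly_in (q : {poly k}) : F := (FracField.tofrac q)%:A.
Definition const_in (c : k) : F := poly_in c%:P.

Section Places.

Implicit Types (E : {subfield F}) (P Q v : F -> int).

(* A place of E, given by its normalized discrete valuation, trivial on k.
   The value 0 at 0 and outside E is a convention: it makes two valuations
   of the same place equal as functions, and v z is meaningful only for
   nonzero z in E. *)
Record is_place E v : Prop := IsPlace {
  place0 : v 0 = 0;
  place_out : forall z, z \notin E -> v z = 0;
  place_const : forall c, v (const_in c) = 0;
  placeM : forall a b, a \in E -> b \in E -> a != 0 -> b != 0 ->
    v (a * b) = v a + v b;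
  placeD : forall a b, a \in E -> b \in E -> a != 0 -> b != 0 -> a + b != 0 ->
    Num.min (v a) (v b) <= v (a + b);
  place_onto : exists2 t, t \in E & v t = 1
}.

Definition val_ring E v : {pred F} := [pred z | (z \in E) && (0 <= v z)].

(* Q is the place (x - alpha) of k(x) *)
Definition place_at (alpha : k) Q : Prop :=
  is_place 1 Q /\ forall q : {poly k}, q != 0 -> Q (poly_in q) = (mup alpha q)%:Z.

(* Inclusion of the maximal ideals; P is a place of an extension of E. *)
Definition lies_over E Q P : Prop := forall z, z \in E -> 0 < Q z -> 0 < P z.

Definition ram_index E Q P (e : nat) : Prop :=
  lies_over E Q P /\ forall z, z \in E -> P z = e%:Z * Q z.

Definition ramified E Q : Prop :=
  exists P e, [/\ is_place {:F} P, ram_index E Q P e & (1 < e)%N].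

Definition totally_ramified E Q : Prop :=
  exists P, is_place {:F} P /\ ram_index E Q P (\dim_E {:F}).

Definition int_closure E Q (z : F) : Prop :=
  exists q : {poly F}, [/\ q \is monic, q \is a polyOver (val_ring E Q) & root q z].

(* The complementary module of the integral closure of the valuation ring. *)
Definition compl_module E Q (z : F) : Prop :=
  forall u, int_closure E Q u -> galTrace E {:F} (z * u) \in val_ring E Q.

(* d = - v_P(t), where t generates the complementary module *)
Definition different_exponent E Q P (d : int) : Prop :=
  exists t : F, [/\ forall z, compl_module E Q z <->
                      exists2 u, int_closure E Q u & z = t * u
                  & d = - P t].

End Places.

Definition place := {v : F -> int | `[< is_place {:F} v >]}.

Definition divisor := {fsfun place -> int with 0}.

(* All places have degree 1, the constant field being algebraically closed. *)
Definition deg_div (D : divisor) : int := (\sum_(P <- finsupp D) D P)%R.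

Definition rr_space (D : divisor) (f : F) : Prop :=
  f = 0 \/ forall P : place, 0 <= val P f + D P.

Definition rr_dim (D : divisor) (d : nat) : Prop :=
  exists b : 'I_d -> F,
    [/\ forall i, rr_space D (b i),
        forall c : 'I_d -> k, \sum_i const_in (c i) * b i = 0 -> forall i, c i = 0
      & forall f, rr_space D f -> exists c : 'I_d -> k,
          f = \sum_i const_in (c i) * b i].

(* g = max over the divisors D of deg D - l(D) + 1 *)
Definition genus (g : nat) : Prop :=
  (exists D d, rr_dim D d /\ deg_div D - d%:Z + 1 = g%:Z) /\
  forall D d, rr_dim D d -> deg_div D - d%:Z + 1 <= g%:Z.

(* The pole divisor of f is a P; only meant for 0 < a. *)
Definition has_pole_divisor (P : F -> int) (a : nat) (f : F) : Prop :=
  P f = - a%:Z /\ forall Q, is_place {:F} Q -> Q <> P -> 0 <= Q f.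

Definition gaps (P : F -> int) : set nat :=
  [set a | (0 < a)%N /\ ~ exists f : F, has_pole_divisor P a f].

Definition is_tower (p n : nat) (L : nat -> {subfield F}) : Prop :=
  [/\ L 0%N = 1%AS, L n = {:F}%AS
    & forall j, (j < n)%N -> (L j <= L j.+1)%VS /\ \dim_(L j) (L j.+1) = p].

(* P i j is the place of L j above (x - alpha i) *)
Definition places_above (s n : nat) (alpha : 'I_s -> k)
    (L : nat -> {subfield F}) (P : 'I_s -> nat -> F -> int) : Prop :=
  forall i, place_at (alpha i) (P i 0%N) /\
    forall j, (j <= n)%N ->
      is_place (L j) (P i j) /\ lies_over 1 (P i 0%N) (P i j).

(* In the last two clauses: div (B j) = A - \sum_i lambda i j * P i j.-1 with A
   effective and prime to the pole divisor; when lambda i j = 0 the place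
   P i j.-1 is neither a zero nor a pole of B j. *)
Definition standard_form (p s n : nat) (L : nat -> {subfield F})
    (P : 'I_s -> nat -> F -> int) (y B : nat -> F)
    (lambda : 'I_s -> nat -> nat) : Prop :=
  forall j, (1 <= j <= n)%N ->
    [/\ [/\ L j = <<L j.-1; y j>>%AS, B j \in L j.-1, B j != 0
          & y j ^+ p - y j = B j],
        forall i, (lambda i j)%:Z = - P i j.-1 (B j),
        forall i, lambda i j = 0%N \/ coprime (lambda i j) p
      & forall Q, is_place (L j.-1) Q -> (forall i, Q <> P i j.-1) ->
          0 <= Q (B j)].

End FunctionField.

Section Boseck.

(* the digit a_j in m = a_1 + a_2 p + ... + a_n p^(n-1) *)
Definition digit (p m j : nat) : nat := ((m %/ p ^ j.-1) %% p)%N.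

Variables (p n s : nat) (delta : 'I_s -> int) (lambda : 'I_s -> nat -> nat).

Definition boseck_num (i : 'I_s) (m : nat) : int :=
  delta i - (\sum_(1 <= j < n.+1) digit p m j * lambda i j * p ^ (n - j))%N%:Z.

Definition boseck_nu (i : 'I_s) (m : nat) : int :=
  (boseck_num i m %/ (p ^ n)%N%:Z)%Z.

Definition boseck_rho (i : 'I_s) (m : nat) : int :=
  boseck_num i m - boseck_nu i m * (p ^ n)%N%:Z.

Definition boseck_Gamma (m : nat) : int := \sum_(i < s) boseck_nu i m.

End Boseck.

(* Main.v *)
Require Import Defs.
From HB Require Import structures.
From mathcomp Require Import zify ring.

Set Implicit Arguments.
Unset Strict Implicit.
Unset Printing Implicit Defensive.

Import Order.TTheory GRing.Theory Num.Theory.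

(** Write N = p^n and, for m < N with base p digits a_1, ..., a_n, let w_m be
    the product of the y_j ^ a_j.

    Local analysis at the ramified points.  At P_l the function w_m has a pole
    of order mu_l(m) = sum_j a_j lambda_(l,j) p^(n-j) ([generator_value],
    [basis_elt_value]).  The lambda_(l,j) are prime to p, so these orders are
    pairwise distinct modulo N ([pole_order_inj]), whereas a function of k(x)
    has a value divisible by N at P_l.  Hence the w_m form a basis of F over
    k(x), and at each P_l the value of a sum of terms c_m w_m is the least
    value of its terms ([val_comb], [val_basis]).

    Local analysis elsewhere.  Up to sign, the basis dual to (w_m) for the
    trace consists of the products of the y_j ^ (p - 1 - a_j) - [a_j = 0]
    ([trace_dual]).  These are regular away from the P_l, so the coefficient
    c_m, which is the trace of f times a dual basis element, is regular at
    each place where the conjugates of f are ([coef_regular]).  To conclude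
    that c_m has no pole as a rational function outside the alpha_l, places of F
    above the other points of the projective line are needed.  They are zeros
    of x - b and 1 / x, and each nonconstant function has a zero
    ([nonconstant_zero]): otherwise its inverse would act on a nonzero
    finite-dimensional space L(D) and be algebraic over k.

    Pole numbers.  Consequently some f has pole divisor a P_i if and only if
    some single term c w_m has.  The conditions on c bound its orders at the
    alpha_l, and a rational function with prescribed orders exists exactly when
    they sum to at most zero.  So a is a pole number at P_i if and only if
    a = mu_i(m) + N t for some m and some t at least equal to the sum over
    l <> i of ceil(mu_l(m) / N) ([pole_number_construct],
    [pole_number_bound]).

    Boseck invariants.  The trace is, up to sign, the coefficient of w_(N-1);
    this determines the complementary module at P_l, and the different exponent
    mu_l(N-1) + N - 1 ([different_exponentE]).  Since N - 1 - m has the digits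
    p - 1 - a_j, the invariant nu_(l, N-1-m) is ceil(mu_l(m) / N).  The gaps in
    the residue class of mu_i(m) modulo N are then the progression attached to
    N - 1 - m ([boseck_progression]). *)

Local Open Scope ring_scope.

(** * Rational functions inside F *)

Section RationalFunctions.

Variables (k : closedFieldType) (F : splittingFieldType {fraction {poly k}}).

Let poly_comp : {rmorphism {poly k} -> F} :=
  in_alg F \o (@FracField.tofrac {poly k}).

HB.instance Definition _ := GRing.RMorphism.copy (poly_in F) poly_comp.

Let const_comp : {rmorphism k -> F} := poly_in F \o polyC.

HB.instance Definition _ := GRing.RMorphism.copy (const_in F) const_comp.

Lemma poly_in_eq0 q : (poly_in F q == 0) = (q == 0).
Proof. by rewrite /poly_in scaler_eq0 oner_eq0 orbF tofrac_eq0. Qed.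

Lemma const_in_eq0 c : (const_in F c == 0) = (c == 0).
Proof. by rewrite poly_in_eq0 polyC_eq0. Qed.

Lemma poly_in_mem q (E : {subfield F}) : poly_in F q \in E.
Proof. by apply: (subvP (sub1v E)); apply/vlineP; exists (FracField.tofrac q). Qed.

Lemma const_in_mem c (E : {subfield F}) : const_in F c \in E.
Proof. exact: poly_in_mem. Qed.

Lemma fraction_quotient (R : idomainType) (c : {fraction R}) :
  exists n d : R, d != 0 /\ c = FracField.tofrac n / FracField.tofrac d.
Proof.
elim/quotW: c => r; exists (frac r).1, (frac r).2; split; first by case: r.
have d_neq0 : FracField.tofrac (frac r).2 != 0 by rewrite tofrac_eq0; case: r.
apply: (mulIf d_neq0); rewrite divfK //.
rewrite -[RHS]/(FracField.tofrac _) -[LHS]/(FracField.mul _ _).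
unlock FracField.tofrac; rewrite !piE; apply/eqmodP => /=.
rewrite FracField.equivfE /FracField.mulf !numden_Ratio ?oner_neq0 ?mulr1 //.
  by rewrite mulrC.
all: by case: {d_neq0} r.
Qed.

Lemma mem1_quotient (z : F) : z \in 1%VS ->
  exists n d : {poly k}, d != 0 /\ z = poly_in F n / poly_in F d.
Proof.
case/vlineP=> c ->; have [n [d [d_neq0 ->]]] := fraction_quotient c.
by exists n, d; split=> //; rewrite -[RHS](fmorph_div (in_alg F)).
Qed.

End RationalFunctions.

(** * Discrete valuations *)

(** One field element can occur along several structure paths.  Abstracting its
    value identifies these occurrences for the arithmetic decision procedures,
    which compare atoms syntactically. *)
Ltac gen_vals v :=
  repeat (let x := fresh "val" in set x := (v _); clearbody x).

Section Valuation.

Variables (k : closedFieldType) (F : splittingFieldType {fraction {poly k}}).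
Variables (E : {subfield F}) (v : F -> int).
Hypothesis Pv : is_place E v.
Implicit Types (z a b : F).

(** Places take the conventional value 0 at 0.  This predicate restores the
    value +oo there, which makes it stable under sums and products without side
    conditions. *)
Definition vge (m : int) (z : F) := (z == 0) || (m <= v z).

Lemma vge0 m : vge m 0.
Proof. by rewrite /vge eqxx. Qed.

Lemma vgeE m z : z != 0 -> vge m z = (m <= v z).
Proof. by rewrite /vge => /negPf->. Qed.

Lemma vge_le m n z : m <= n -> vge n z -> vge m z.
Proof. by move=> mn /orP[z0|nz]; rewrite /vge ?z0 // (le_trans mn nz) orbT. Qed.

Lemma place1 : v 1 = 0.
Proof. by have := place_const Pv 1; rewrite rmorph1. Qed.

Lemma placeX z n : z \in E -> z != 0 -> v (z ^+ n) = n%:Z * v z.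
Proof.
move=> Ez z0; elim: n => [|n IH]; first by rewrite expr0 place1 mul0r.
by rewrite exprS (placeM Pv) ?rpredX ?expf_neq0 // IH; lia.
Qed.

Lemma placeV z : z \in E -> v z^-1 = - v z.
Proof.
move=> Ez; have [->|z0] := eqVneq z 0; first by rewrite invr0 (place0 Pv).
have := placeM Pv Ez (rpredVr Ez) z0; rewrite invr_eq0 divff // place1 => /(_ z0).
by lia.
Qed.

Lemma place_div a b : a \in E -> b \in E -> a != 0 -> b != 0 ->
  v (a / b) = v a - v b.
Proof.
by move=> Ea Eb a0 b0; rewrite (placeM Pv) ?invr_eq0 ?rpredV // placeV.
Qed.

Lemma placeN z : z \in E -> v (- z) = v z.
Proof.
move=> Ez; have [->|z0] := eqVneq z 0; first by rewrite oppr0.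
rewrite -mulN1r (placeM Pv) ?oppr_eq0 ?oner_neq0 ?rpredN1 ?rpredN ?rpred1 //.
by have := place_const Pv (-1); rewrite rmorphN1 => ->; rewrite add0r.
Qed.

Lemma placeZ m z : z \in E -> z != 0 -> v (z ^ m) = m * v z.
Proof.
move=> Ez z0; case: m => n; first exact: placeX.
by rewrite NegzE -exprnN placeV ?rpredX // placeX //; lia.
Qed.

Lemma vgeD m a b : a \in E -> b \in E -> vge m a -> vge m b -> vge m (a + b).
Proof.
move=> Ea Eb; have [->|a0] := eqVneq a 0; first by rewrite add0r.
have [->|b0] := eqVneq b 0; first by rewrite addr0.
have [->|ab0] := eqVneq (a + b) 0; first by rewrite vge0.
by rewrite !vgeE // => am bm; apply: le_trans (placeD Pv Ea Eb a0 b0 ab0); rewrite le_min am bm.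
Qed.

Lemma vgeN m z : z \in E -> vge m (- z) = vge m z.
Proof. by move=> Ez; rewrite /vge oppr_eq0 placeN. Qed.

Lemma vgeB m a b : a \in E -> b \in E -> vge m a -> vge m b -> vge m (a - b).
Proof. by move=> Ea Eb am bm; rewrite vgeD ?rpredN ?vgeN. Qed.

Lemma vgeM m n a b : a \in E -> b \in E ->
  vge m a -> vge n b -> vge (m + n) (a * b).
Proof.
move=> Ea Eb am bn; have [a0|a0] := eqVneq a 0; first by rewrite a0 mul0r vge0.
have [b0|b0] := eqVneq b 0; first by rewrite b0 mulr0 vge0.
move: am bn; rewrite !vgeE ?mulf_neq0 // (placeM Pv) //; lia.
Qed.

Lemma vge_sum m (I : Type) (r : seq I) (P : pred I) (u : I -> F) :
  (forall i, P i -> u i \in E) -> (forall i, P i -> vge m (u i)) ->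
  vge m (\sum_(i <- r | P i) u i).
Proof.
move=> Eu um; suff /andP[] : (\sum_(i <- r | P i) u i \in E) &&
  vge m (\sum_(i <- r | P i) u i) by [].
elim/big_ind: _ => [|a b /andP[Ea am] /andP[Eb bm]|i Pi].
- by rewrite rpred0 vge0.
- by rewrite rpredD // vgeD.
- by rewrite Eu // um.
Qed.

Lemma vge_prod (I : Type) (r : seq I) (P : pred I) (u : I -> F) :
  (forall i, P i -> u i \in E) -> (forall i, P i -> vge 0 (u i)) ->
  vge 0 (\prod_(i <- r | P i) u i).
Proof.
move=> Eu um; suff /andP[] : (\prod_(i <- r | P i) u i \in E) &&
  vge 0 (\prod_(i <- r | P i) u i) by [].
elim/big_ind: _ => [|a b /andP[Ea am] /andP[Eb bm]|i Pi].
- by rewrite rpred1 /vge place1 orbT.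
- by rewrite rpredM // -[0]addr0 vgeM.
- by rewrite Eu // um.
Qed.

Lemma vgeX z n : z \in E -> vge 0 z -> vge 0 (z ^+ n).
Proof. by move=> Ez z0; rewrite -[n]card_ord -prodr_const; apply: vge_prod. Qed.

Lemma vge_const c : vge 0 (const_in F c).
Proof. by rewrite /vge (place_const Pv) orbT. Qed.

(** Otherwise a, being the difference of a + b and b, would have too large a
    value. *)
Lemma place_dominant a b : a \in E -> b \in E -> a != 0 ->
  vge (v a + 1) b -> a + b != 0 /\ v (a + b) = v a.
Proof.
move=> Ea Eb a0 ab.
have [b0|b0] := eqVneq b 0; first by rewrite b0 addr0.
move: ab; rewrite vgeE // => ab.
have ab0 : a + b != 0.
  by apply: contraTneq ab => /eqP; rewrite addrC addr_eq0 => /eqP ->; rewrite placeN //; lia.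
split=> //; have := placeD Pv Ea Eb a0 b0 ab0.
have Nb0 : - b != 0 by rewrite oppr_eq0.
have := placeD Pv (rpredD Ea Eb) (rpredNr Eb) ab0 Nb0.
rewrite addrK => /(_ a0); rewrite placeN //; move: ab.
gen_vals v; lia.
Qed.

(** Valuation rings are integrally closed: in a monic equation the leading
    term would dominate at a pole. *)
Lemma vge_root (q : {poly F}) z : q \is monic -> q \is a polyOver E ->
  (forall i, vge 0 q`_i) -> root q z -> z \in E -> vge 0 z.
Proof.
move=> mq Eq qi qz Ez; apply/negPn/negP; rewrite /vge negb_or => /andP[z0].
rewrite -ltNge => vz.
have sq : (0 < size q)%N by rewrite size_poly_gt0 monic_neq0.
pose n := (size q).-1.
have En : size q = n.+1 by rewrite prednK.
move: qz; rewrite /root horner_coef En big_ord_recr /=.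
have -> : q`_n = 1 by have /monicP := mq; rewrite lead_coefE En.
rewrite mul1r addrC; set a := z ^+ n; set b := \sum_(i < n) _.
have [|||| + _] := @place_dominant a b; last by move/negPf->.
- by rewrite rpredX.
- by rewrite rpred_sum // => i _; rewrite rpredM ?rpredX //; apply/polyOverP.
- by rewrite expf_neq0.
- apply: vge_sum => i _; first by rewrite rpredM ?rpredX //; apply/polyOverP.
  rewrite -[_ + 1]add0r vgeM ?rpredX //; first exact/polyOverP.
  rewrite vgeE ?expf_neq0 // !placeX //; have := ltn_ord i; nia.
Qed.

Lemma artin_schreier_integral p z b : prime p ->
  z \in E -> b \in E -> z ^+ p - z = b -> vge 0 b -> vge 0 z.
Proof.
move=> pp Ez Eb <-; apply: contraTT; rewrite /vge negb_or -ltNge => /andP[z0 vz].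
have [||||h1 h2] := @place_dominant (z ^+ p) (- z).
- exact: rpredX.
- by rewrite rpredN.
- exact: expf_neq0.
- rewrite vgeN // vgeE // placeX //; have := prime_gt1 pp; nia.
by rewrite (negPf h1) h2 placeX // -ltNge; have := prime_gt1 pp; nia.
Qed.

(** At a pole of z the term z ^ p dominates z ^ p - z. *)
Lemma artin_schreier_pole p z b : prime p ->
  z \in E -> b \in E -> z ^+ p - z = b -> v b < 0 -> p%:Z * v z = v b.
Proof.
move=> pp Ez Eb zb vb.
have b0 : b != 0 by apply: contraTneq vb => ->; rewrite (place0 Pv).
have z0 : z != 0.
  by apply: contraNneq b0 => z0; rewrite -zb z0 expr0n subr0 eqn0Ngt prime_gt0.
have vz : v z < 0.
  rewrite ltNge; apply: contraTN vb => vz; rewrite -leNgt.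
  by rewrite -[_ <= _](vgeE _ b0) -zb vgeB ?rpredX ?vgeX ?vgeE.
rewrite -zb; have [||||_ ->] := @place_dominant (z ^+ p) (- z).
- exact: rpredX.
- by rewrite rpredN.
- exact: expf_neq0.
- rewrite vgeN // vgeE // placeX //; have := prime_gt1 pp; nia.
by rewrite placeX.
Qed.

(** Terms of pairwise distinct values cannot cancel, so that the least value
    survives in the sum. *)
Lemma val_sum_distinct (I : finType) (u : I -> F) :
  (forall i, u i \in E) ->
  (forall i j, u i != 0 -> u j != 0 -> v (u i) = v (u j) -> i = j) ->
  (forall i, u i = 0) \/
  exists i0, [/\ u i0 != 0, \sum_i u i != 0, v (\sum_i u i) = v (u i0)
    & forall i, vge (v (u i0)) (u i)].
Proof.
move=> Eu uI; have [/existsP[i1 i1P]|/existsPn u0] := boolP [exists i, u i != 0]; last first.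
  by left=> i; apply/eqP; have := u0 i; rewrite negbK.
right; case: (Order.TotalTheory.arg_minP (P := fun i => u i != 0) (fun i => v (u i)) i1P) => i0 i0P i0min.
have [|||] := @place_dominant (u i0) (\sum_(i | i != i0) u i) (Eu i0).
- exact: rpred_sum.
- by [].
- apply: vge_sum => // i ii0; have [->|ui0] := eqVneq (u i) 0; first exact: vge0.
  rewrite vgeE //; have := i0min i ui0; rewrite le_eqVlt => /orP[/eqP e|]; last by lia.
  by rewrite (uI _ _ i0P ui0 e) eqxx in ii0.
move=> s0 sv; exists i0; rewrite (bigD1 i0) //=; split=> // i.
by have [->|ui0] := eqVneq (u i) 0; rewrite ?vge0 // vgeE // i0min.
Qed.

End Valuation.

(** * Comparison of places *)

Section PlaceComparison.

Variables (k : closedFieldType) (F : splittingFieldType {fraction {poly k}}).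
Variables (E : {subfield F}) (v w : F -> int).
Hypotheses (Pv : is_place {:F} v) (Pw : is_place E w).
Implicit Types (z a b t : F).

(** Valuation rings of discrete valuations are maximal: an inclusion between
    two of them forces proportional valuations.  The factor is the value at v
    of a uniformizer t of w. *)
Lemma place_dominated : (forall z, z \in E -> vge v 0 z -> vge w 0 z) ->
  (exists2 z, z \in E & 0 < v z /\ 0 < w z) ->
  forall t, t \in E -> w t = 1 -> 0 < v t /\ forall z, z \in E -> v z = v t * w z.
Proof.
move=> vw [b Eb [vb wb]] t Et wt.
have b0 : b != 0 by apply: contraTneq wb => ->; rewrite (place0 Pw).
have vwz z : z \in E -> z != 0 -> 0 <= v z -> 0 <= w z.
  by move=> Ez z0 vz; rewrite -(vgeE w _ z0) vw // vgeE.
have pos z : z \in E -> w z = 0 -> v z <= 0.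
  move=> Ez wz; rewrite leNgt; apply/negP => vz.
  have z0 : z != 0 by apply: contraTneq vz => ->; rewrite (place0 Pv).
  (* a high power of z outweighs b at v, but not at w *)
  have := vwz (z ^+ `|v b|%N / b); rewrite rpred_div ?rpredX //.
  rewrite mulf_neq0 ?invr_eq0 ?expf_neq0 //.
  rewrite (place_div Pw) ?rpredX ?expf_neq0 // (placeX Pw) // wz.
  rewrite (place_div Pv) ?memvf ?expf_neq0 // (placeX Pv) ?memvf //.
  by move=> /(_ isT isT); nia.
have unit z : z \in E -> w z = 0 -> v z = 0.
  move=> Ez wz; apply/eqP; rewrite eq_le pos //=.
  by have := pos z^-1; rewrite rpredV (placeV Pw) // (placeV Pv) ?memvf // wz oppr0 => /(_ Ez erefl); lia.
have t0 : t != 0 by apply: contra_eqN wt => /eqP ->; rewrite (place0 Pw).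
have vE z : z \in E -> v z = v t * w z.
  move=> Ez; have [->|z0] := eqVneq z 0; first by rewrite (place0 Pv) (place0 Pw) mulr0.
  have Etw : t ^ w z \in E by rewrite rpredXz.
  have := unit (z / t ^ w z); rewrite rpred_div // (place_div Pw) ?expfz_neq0 //.
  rewrite (placeZ Pw) // wt mulr1 subrr => /(_ isT erefl).
  by rewrite (place_div Pv) ?memvf ?expfz_neq0 // (placeZ Pv) ?memvf //; lia.
by split=> //; move: vb; rewrite vE //; nia.
Qed.

End PlaceComparison.

Section TotallyRamified.

Variables (k : closedFieldType) (F : splittingFieldType {fraction {poly k}}).
Variables (Q v : F -> int).
Hypotheses (PQ : is_place 1%AS Q) (Pv : is_place {:F} v).
Let N : nat := \dim {:F}.
Hypothesis vQ : forall z, z \in 1%VS -> v z = N%:Z * Q z.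
Implicit Types (z a b t : F).

(** The hypothesis only concerns elements of positive value.  A unit z of Q
    with a pole at w is excluded by applying it to z ^ M * b for a uniformizer
    b and a large exponent M. *)
Lemma lies_over_vge (E : {subfield F}) w : is_place E w -> lies_over 1 Q w ->
  forall z, z \in 1%VS -> vge Q 0 z -> vge w 0 z.
Proof.
move=> Pw over z Kz; have [->|z0] := eqVneq z 0; first by rewrite !vge0.
rewrite !vgeE // le_eqVlt => /orP[/eqP Qz|]; last by move/(over _ Kz)/ltW.
rewrite leNgt; apply/negP => wz.
have [b Kb Qb] := place_onto PQ.
have b0 : b != 0 by apply: contra_eqN Qb => /eqP ->; rewrite (place0 PQ).
have sKE := subvP (sub1v E).
have wb : 0 < w b by apply: over; rewrite ?Qb.
have := over (z ^+ `|w b|%N * b).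
rewrite rpredM ?rpredX // (placeM PQ) ?rpredX ?expf_neq0 // (placeX PQ) //.
rewrite (placeM Pw) ?rpredX ?expf_neq0 ?sKE // (placeX Pw) ?sKE //.
rewrite -Qz Qb mulr0 add0r => /(_ isT isT); nia.
Qed.

Section ValuationBasis.

Variable u : 'I_N -> F.
Hypothesis u_neq0 : forall i, u i != 0.
Hypothesis u_distinct : forall i j, (N%:Z %| v (u i) - v (u j))%Z -> i = j.

(** Multiplying by functions of the base field changes values by multiples
    of the degree N, so elements with values distinct modulo N remain of
    distinct values after any such scaling; this is also why N of them form a
    basis. *)
Lemma val_comb (c : 'I_N -> F) : (forall i, c i \in 1%VS) ->
  (forall i, c i = 0) \/
  exists i0, [/\ c i0 != 0, \sum_i c i * u i != 0,
    v (\sum_i c i * u i) = N%:Z * Q (c i0) + v (u i0)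
    & forall i, vge v (v (\sum_i c i * u i)) (c i * u i)].
Proof.
move=> Kc.
have vcu i : c i * u i != 0 -> v (c i * u i) = N%:Z * Q (c i) + v (u i).
  rewrite mulf_eq0 negb_or => /andP[ci0 ui0].
  by rewrite (placeM Pv) ?memvf // vQ.
have [|||[i0 [cu0 s0 sv smin]]] := @val_sum_distinct _ _ {:F}%AS v Pv _ (fun i => c i * u i).
- by move=> i; rewrite memvf.
- move=> i j ci cj; rewrite !vcu // => e; apply: u_distinct.
  by apply/dvdzP; exists (Q (c j) - Q (c i)); lia.
- move=> cu0; left=> i; have /eqP := cu0 i.
  by rewrite mulf_eq0 (negPf (u_neq0 i)) orbF => /eqP.
right; exists i0; split=> //; last by rewrite sv.
  by apply: contraNneq cu0 => ->; rewrite mul0r.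
by rewrite sv vcu.
Qed.

Lemma val_basis z : exists2 c : 'I_N -> F,
  (forall i, c i \in 1%VS) & z = \sum_i c i * u i.
Proof.
pose X := [tuple u i | i < N].
have frX : free X.
  apply/freeP => c; rewrite (eq_bigr (fun i => (c i)%:A * u i)); last first.
    by move=> i _; rewrite (nth_map i) ?size_enum_ord // nth_ord_enum mulr_algl.
  have Kc i : (c i)%:A \in (1%VS : {vspace F}) by apply/vlineP; exists (c i).
  move=> s0 i; have [c0|[i0 [_]]] := val_comb Kc; last by rewrite s0 eqxx.
  by apply/eqP; have /eqP := c0 i; rewrite scaler_eq0 oner_eq0 orbF.
have bX : basis_of {:F} X by rewrite basisEfree frX subvf size_tuple /=.
exists (fun i => (coord X i z)%:A); first by move=> i; apply/vlineP; exists (coord X i z).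
rewrite {1}(coord_basis bX (memvf z)); apply: eq_bigr => i _.
by rewrite (nth_map i) ?size_enum_ord // nth_ord_enum mulr_algl.
Qed.

End ValuationBasis.

(** For z of nonnegative value at v, all powers of z lie in the lattice spanned
    over the valuation ring of Q by 1, t, ..., t ^ (N - 1), with t a
    uniformizer of v.  The valuation w is bounded below on this lattice, so z
    cannot have a pole at w.  Thus w dominates v, and they agree. *)
Lemma totally_ramified_unique w : is_place {:F} w -> lies_over 1 Q w -> w = v.
Proof.
move=> Pw over; have [t _ vt] := place_onto Pv.
have t0 : t != 0 by apply: contra_eqN vt => /eqP ->; rewrite (place0 Pv).
pose u (i : 'I_N) := t ^+ i.
have u0 i : u i != 0 by rewrite expf_neq0.
have vu i : v (u i) = i by rewrite (placeX Pv) ?memvf // vt mulr1.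
have uI i j : (N%:Z %| v (u i) - v (u j))%Z -> i = j.
  rewrite !vu -eqz_mod_dvd !modz_nat !modn_small ?ltn_ord // => /eqP[ij].
  exact: val_inj.
have vw z : z \in {:F}%VS -> vge v 0 z -> vge w 0 z.
  move=> _ vz; apply/negPn/negP; rewrite /vge negb_or => /andP[z0]; rewrite -ltNge => wz.
  pose M := \sum_(i < N) `|w (u i)|%N.
  have uM i : - (M%:Z) <= w (u i).
    have : (`|w (u i)| <= M)%N by rewrite /M (bigD1 i) //= leq_addr.
    by lia.
  (* powers of z stay in the lattice spanned by the t ^+ i over the valuation
     ring of Q, on which w is bounded below *)
  have [c Kc zc] := val_basis u0 uI (z ^+ M.+1).
  suff : vge w (- M%:Z) (z ^+ M.+1).
    by rewrite vgeE ?expf_neq0 // (placeX Pw) ?memvf //; nia.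
  rewrite zc; apply: (vge_sum Pw) => i _; first exact: memvf.
  have [c0|[i0 [ci0 s0 sv smin]]] := val_comb u0 uI Kc.
    by rewrite c0 mul0r vge0.
  have : vge v 0 (c i * u i).
    by apply: vge_le (smin i); rewrite -zc -(vgeE v) ?expf_neq0 // (vgeX Pv) ?memvf.
  have [->|ci] := eqVneq (c i) 0; first by rewrite mul0r !vge0.
  rewrite vgeE ?mulf_neq0 ?u0 // (placeM Pv) ?memvf ?u0 // vQ // vu => h.
  have Qc : vge Q 0 (c i) by rewrite vgeE //; have := ltn_ord i; nia.
  rewrite -[- _]add0r (vgeM Pw) ?memvf //; first exact: (lies_over_vge Pw over).
  by rewrite vgeE ?u0.
have [b Kb Qb] := place_onto PQ.
have N0 : (0 < N)%N by rewrite adim_gt0.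
have [s _ ws] := place_onto Pw.
have [|vs vE] := @place_dominated _ _ _ v w Pv Pw vw _ s (memvf _) ws.
  exists b; rewrite ?memvf // vQ // Qb; split; first by lia.
  by apply: over => //; rewrite Qb.
apply/funext => z; have := vE t (memvf t); rewrite vt => e.
suff vs1 : v s = 1 by rewrite vE ?memvf // vs1 mul1r.
move: (v s) (w t) e vs => c d e c0; have d0 : 0 < d by nia.
nia.
Qed.

End TotallyRamified.

(** * Galois conjugates and residues at a totally ramified place *)

Section ConjugatePlaces.

Variables (k : closedFieldType) (F : splittingFieldType {fraction {poly k}}).
Implicit Types (z a b t : F).

Lemma gal_fix1 (x : gal_of {:F}) z : z \in 1%VS -> x z = z.
Proof.
case/vlineP=> c ->; rewrite linearZ /=; congr (_ *: _); exact: rmorph1.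
Qed.

Lemma gal_place w (x : gal_of {:F}) :
  is_place {:F} w -> is_place {:F} (w \o x).
Proof.
move=> Pw; split=> /=.
- by rewrite rmorph0 (place0 Pw).
- by move=> z; rewrite memvf.
- by move=> c; rewrite gal_fix1 ?poly_in_mem // (place_const Pw).
- move=> a b _ _ a0 b0; rewrite rmorphM (placeM Pw) ?memvf //.
  + by rewrite fmorph_eq0.
  + by rewrite fmorph_eq0.
- move=> a b _ _ a0 b0 ab0; rewrite rmorphD (placeD Pw) ?memvf //.
  + by rewrite fmorph_eq0.
  + by rewrite fmorph_eq0.
  + by rewrite -rmorphD fmorph_eq0.
- have [t _ wt] := place_onto Pw; exists ((x^-1)%g t); rewrite ?memvf //=.
  by rewrite -galM ?memvf // mulVg gal_id.
Qed.

End ConjugatePlaces.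

Section TotallyRamifiedGalois.

Variables (k : closedFieldType) (F : splittingFieldType {fraction {poly k}}).
Variables (Q v : F -> int).
Hypotheses (PQ : is_place 1%AS Q) (Pv : is_place {:F} v).
Hypothesis vQ : forall z, z \in 1%VS -> v z = (\dim {:F})%:Z * Q z.
Implicit Types (z a b t : F).

Let N0 : 0 < (\dim {:F})%:Z.
Proof. by rewrite ltz_nat adim_gt0. Qed.

(** A conjugate of v lies over the same place of k(x), and v is the only place
    above it. *)
Lemma totally_ramified_gal (x : gal_of {:F}) z : v (x z) = v z.
Proof.
suff vx : v \o x = v by rewrite -{2}vx.
apply: (totally_ramified_unique PQ Pv vQ); first exact: gal_place.
by move=> a Ka Qa /=; rewrite gal_fix1 // vQ //; nia.
Qed.

Lemma vge_base z : z \in 1%VS -> vge v 0 z = vge Q 0 z.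
Proof.
by move=> Kz; rewrite /vge; case: eqP => //= _; rewrite vQ // pmulr_rge0.
Qed.

Lemma vge_coef_prod (r : seq F) i : (forall b, b \in r -> vge v 0 b) ->
  vge v 0 (\prod_(b <- r) ('X - b%:P))`_i.
Proof.
elim: r i => [|b r IH] i rv.
  by rewrite big_nil coef1; case: eqP => _; rewrite ?vge0 // /vge (place1 Pv) lexx orbT.
have IHr j : vge v 0 (\prod_(b <- r) ('X - b%:P))`_j.
  by apply: IH => c cr; apply: rv; rewrite inE cr orbT.
rewrite big_cons mulrBl coefB coefXM coefCM (vgeB Pv) ?memvf //.
  by case: eqP => _; rewrite ?vge0.
by rewrite -[0]addr0 (vgeM Pv) ?memvf // rv // mem_head.
Qed.

(** Conjugation preserves v, so the minimal polynomial of an element of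
    nonnegative value has coefficients of nonnegative value. *)
Lemma int_closure_vge : galois 1%AS {:F}%AS ->
  forall z, int_closure 1%AS Q z <-> vge v 0 z.
Proof.
move=> gF z; split.
  case=> q [mq qQ qz]; apply: (vge_root Pv mq _ _ qz (memvf _)).
    by apply/polyOverP => i; rewrite memvf.
  move=> i; have [iq|qi] := ltnP i (size q); last by rewrite nth_default ?vge0.
  move: qQ; rewrite qualifE /= => /(all_nthP 0)/(_ i iq); rewrite inE => /andP[Kq Qq].
  by rewrite vge_base // /vge Qq orbT.
move=> vz; exists (minPoly 1 z); split; first exact: monic_minPoly.
  rewrite qualifE /=; apply/(all_nthP 0) => i _; rewrite inE.
  have Kc : (minPoly 1 z)`_i \in (1%VS : {vspace F}).
    exact: (polyOverP (minPolyOver 1 z) i).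
  apply/andP; split; first exact: Kc.
  have : vge v 0 (minPoly 1 z)`_i.
    have [r [_ _ ->]] := galois_factors (sub1v _) gF z (memvf z).
    apply: vge_coef_prod => b /mapP[x _ ->].
    by move: vz; rewrite /vge totally_ramified_gal fmorph_eq0.
  by rewrite vge_base // => /orP[/eqP ->|//]; rewrite (place0 PQ).
exact: root_minPoly.
Qed.

Variable alpha : k.
Hypothesis Qalpha : forall q, q != 0 -> Q (poly_in F q) = (mup alpha q)%:Z.

(** The residue is found by evaluating a reduced fraction at alpha. *)
Lemma residue_base z : z \in 1%VS -> vge Q 0 z ->
  exists c, vge Q 1 (z - const_in F c).
Proof.
move=> Kz; have [n [d [d0 ->]]] := mem1_quotient Kz.
have [->|n0] := eqVneq n 0.
  by exists 0; rewrite !rmorph0 mul0r subrr vge0.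
have pn0 : poly_in F n != 0 by rewrite poly_in_eq0.
have pd0 : poly_in F d != 0 by rewrite poly_in_eq0.
rewrite vgeE ?mulf_neq0 ?invr_eq0 // (place_div PQ) ?poly_in_mem // !Qalpha //.
have [m [n1 /[!n0]/= n1a nE]] := multiplicity_XsubC n alpha.
have [e [d1 /[!d0]/= d1a dE]] := multiplicity_XsubC d alpha.
rewrite nE dE !mupMr // !mup_XsubCX eqxx subr_ge0 => le_em.
have {}le_em : (e <= m)%N by lia.
pose n2 := n1 * ('X - alpha%:P) ^+ (m - e).
exists (n2.[alpha] / d1.[alpha]).
have d10 : d1 != 0 by apply: contraNneq d1a => ->; rewrite root0.
have pd10 : poly_in F d1 != 0 by rewrite poly_in_eq0.
have -> : poly_in F (n1 * ('X - alpha%:P) ^+ m) / poly_in F (d1 * ('X - alpha%:P) ^+ e)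
   = poly_in F n2 / poly_in F d1.
  apply/eqP; rewrite eqr_div //; last by rewrite -dE.
  rewrite -!rmorphM; apply/eqP; congr (poly_in F _).
  by rewrite -[in LHS](subnK le_em) exprD /n2; ring.
have cE c : const_in F c = poly_in F c%:P by [].
rewrite -[const_in F _](mulfK pd10) -mulrBl cE.
rewrite -rmorphM -rmorphB; set q := n2 - _.
have [->|q0] := eqVneq q 0; first by rewrite rmorph0 mul0r vge0.
have pq0 : poly_in F q != 0 by rewrite poly_in_eq0.
rewrite vgeE ?mulf_neq0 ?invr_eq0 // (place_div PQ) ?poly_in_mem // !Qalpha //.
rewrite (mupNroot d1a) subr0 lez_nat -XsubC_dvd // dvdp_XsubCl /root /q.
by rewrite hornerD hornerN hornerCM divfK ?subrr.
Qed.

(** The residue field does not grow: in the expansion of z along the powers of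
    a uniformizer, only the constant term contributes to the residue. *)
Lemma residue_const z : vge v 0 z -> exists c, vge v 1 (z - const_in F c).
Proof.
have [t _ vt] := place_onto Pv.
have t0 : t != 0 by apply: contra_eqN vt => /eqP ->; rewrite (place0 Pv).
pose u (i : 'I_(\dim {:F})) := t ^+ i.
have u0 i : u i != 0 by rewrite expf_neq0.
have vu i : v (u i) = i by rewrite (placeX Pv) ?memvf // vt mulr1.
have uI i j : ((\dim {:F})%:Z %| v (u i) - v (u j))%Z -> i = j.
  rewrite !vu -eqz_mod_dvd !modz_nat !modn_small ?ltn_ord // => /eqP[ij].
  exact: val_inj.
have [c Kc ->] := val_basis Pv vQ u0 uI z => vz.
have smin i : vge v 0 (c i * u i).
  have [c0|[i0 [ci0 s0 sv smin]]] := val_comb Pv vQ u0 uI Kc.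
    by rewrite c0 mul0r vge0.
  by apply: vge_le (smin i); rewrite -(vgeE v).
have Qc i : vge Q 0 (c i).
  have := smin i; have [->|ci] := eqVneq (c i) 0; first by rewrite !vge0.
  rewrite !vgeE ?mulf_neq0 ?u0 // (placeM Pv) ?memvf ?u0 // vu vQ ?Kc //.
  by have := ltn_ord i; nia.
have dim0 : (0 < \dim {:F})%N by rewrite adim_gt0.
have [e he] := residue_base (Kc (Ordinal dim0)) (Qc _).
have ui0 : u (Ordinal dim0) = 1 by rewrite /u expr0.
exists e; rewrite (bigD1 (Ordinal dim0)) //= ui0 mulr1 addrAC.
rewrite (vgeD Pv) ?memvf //.
  move: he; rewrite /vge; case: eqP => //= _.
  rewrite vQ ?rpredB ?const_in_mem ?Kc // => q1; apply: (le_trans q1).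
  by rewrite ler_peMl ?(le_trans ler01 q1).
apply: (vge_sum Pv) => [i|i i0]; first by rewrite memvf.
rewrite -[1]add0r (vgeM Pv) ?memvf ?vge_base // vgeE ?u0 // vu.
by case: i i0 => [[|i] ?] //=; rewrite -val_eqE.
Qed.

End TotallyRamifiedGalois.

(** * Power sums over the prime field *)

Section PowerSums.

Variables (A : fieldType) (p : nat).
Hypothesis charA : p \in [pchar A].
Implicit Types (c x y b : A).

Let p_prime : prime p. Proof. exact: pcharf_prime charA. Qed.

Lemma natf_inj_pchar m l : (m < p)%N -> (l < p)%N -> m%:R = l%:R :> A -> m = l.
Proof.
wlog lm : m l / (l <= m)%N => [th mp lp|mp _ /eqP].
  by case: (leqP l m) => [|/ltnW] lm e; [|apply/esym]; apply: th.
rewrite -subr_eq0 -natrB // -(dvdn_pcharf charA) => /dvdn_leq h.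
by apply/eqP; rewrite eqn_leq lm andbT -subn_eq0 -leqn0 leqNgt; apply/negP => /h; lia.
Qed.

Let prime_field_roots := [seq l%:R : A | l <- iota 0 p].

Lemma uniq_prime_field : uniq prime_field_roots.
Proof.
rewrite map_inj_in_uniq ?iota_uniq // => m l.
by rewrite !mem_iota !add0n => /andP[_ mp] /andP[_ lp]; apply: natf_inj_pchar.
Qed.

Lemma natf_exp_pchar l : (l%:R : A) ^+ p = l%:R.
Proof. by rewrite -(pFrobenius_autE charA) pFrobenius_aut_nat. Qed.

(** The polynomial X ^ p - X has no more than p roots, and the prime field
    provides p of them. *)
Lemma prime_fieldP c : c ^+ p = c -> exists2 l, (l < p)%N & c = l%:R.
Proof.
move=> cp; have [/mapP[l]|nc] := boolP (c \in prime_field_roots).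
  by rewrite mem_iota add0n => /andP[_ lp] ->; exists l.
have : ('X^p - 'X : {poly A}) = 0.
  apply: (@roots_geq_poly_eq0 _ _ (c :: prime_field_roots)).
  - apply/allP => x; rewrite inE => /orP[/eqP ->|/mapP[l _ ->]];
    by rewrite /root !hornerE ?natf_exp_pchar ?cp subrr.
  - by rewrite /= nc uniq_prime_field.
  - rewrite /= size_map size_iota size_polyDl ?size_polyXn //.
    by rewrite size_polyN size_polyX ltnS prime_gt1.
move/(congr1 (fun q : {poly A} => q`_p)).
rewrite coefB coefXn eqxx coefX coef0 (gtn_eqF (prime_gt1 p_prime)) subr0 => /eqP.
by rewrite oner_eq0.
Qed.

Let S r : {poly A} := \sum_(l < p) ('X + (l%:R)%:P) ^+ r.

(* S r is invariant under translation by 1.  For r < p this makes it constant,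
   because the p elements of the prime field are roots of S r - S r (0), whose
   degree is below p.  Since the derivative of S r is r S (r - 1), the power
   sums of exponent below p - 1 vanish. *)
Let S_shift r x : (S r).[x + 1] = (S r).[x].
Proof.
have E z : (S r).[z] = \sum_(0 <= l < p) (z + l%:R) ^+ r.
  by rewrite horner_sum big_mkord; apply: eq_bigr => l _; rewrite !hornerE.
rewrite !E; have /prednK pE := prime_gt0 p_prime.
rewrite -pE big_nat_recr // [RHS]big_nat_recl //= addrC; congr (_ + _).
  by rewrite -addrA -mulrS pE (pcharf0 charA) !addr0.
by apply: eq_bigr => l _; rewrite -addrA -mulrS.
Qed.

Let S_const r : (r < p)%N -> S r = ((S r).[0])%:P.
Proof.
move=> rp; apply/eqP; rewrite -subr_eq0; apply/eqP.
apply: (@roots_geq_poly_eq0 _ _ prime_field_roots).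
- apply/allP => _ /mapP[m _ ->]; rewrite /root hornerD hornerN hornerC subr_eq0.
  apply/eqP; elim: m => [//|m <-]; by rewrite -[m.+1]addn1 natrD S_shift.
- exact: uniq_prime_field.
- rewrite size_map size_iota; apply: leq_trans (size_polyD _ _) _.
  rewrite size_polyN geq_max; apply/andP; split.
    apply: leq_trans (size_sum _ _ _) _; apply/bigmax_leqP => l _.
    by rewrite -[_%:P]opprK -polyCN size_exp_XsubC.
  by rewrite (leq_trans (size_polyC_leq1 _)) ?prime_gt0.
Qed.

Let S_deriv r : (S r.+1)^`() = r.+1%:R *: S r.
Proof.
rewrite /S raddf_sum scaler_sumr; apply: eq_bigr => l _ /=.
by rewrite deriv_exp derivD derivX derivC addr0 mul1r scaler_nat.
Qed.

Let S_eq0 r : (r < p.-1)%N -> S r = 0.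
Proof.
move=> rp; have rp' : (r.+1 < p)%N by move: rp; have := prime_gt1 p_prime; lia.
have /eqP := S_deriv r; rewrite S_const // derivC eq_sym scaler_eq0 => /orP[|/eqP//].
by rewrite -(dvdn_pcharf charA) gtnNdvd.
Qed.

Let S_top : S p.-1 = -1.
Proof.
have p1 := prime_gt1 p_prime.
rewrite S_const ?ltn_predL ?prime_gt0 //.
rewrite horner_sum; have -> : -1 = (-1)%:P :> {poly A} by rewrite polyCN.
congr _%:P; have pE : p = p.-1.+1 by lia.
have N1 : -1 = (p.-1)%:R :> A.
  by apply/esym/eqP; rewrite -addr_eq0 natr1 -pE (pcharf0 charA).
transitivity (\sum_(0 <= l < p) (l%:R : A) ^+ p.-1).
  by rewrite big_mkord; apply: eq_bigr => l _; rewrite !hornerE.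
rewrite big_ltn ?prime_gt0 // expr0n (_ : (p.-1 == 0)%N = false) ?add0r; last by lia.
rewrite (eq_big_nat _ _ (F2 := fun=> 1)) ?sumr_const_nat ?subn1 -?N1 // => l /andP[l0 lp].
have lF0 : (l%:R : A) != 0 by rewrite -(dvdn_pcharf charA) gtnNdvd.
by apply: (mulfI lF0); rewrite -exprS -pE natf_exp_pchar mulr1.
Qed.

Lemma power_sum y c r : c ^+ p = c -> c != 0 -> (r < p)%N ->
  \sum_(l < p) (y + l%:R * c) ^+ r = - (r == p.-1)%:R.
Proof.
move=> cp c0 rp; have -> : \sum_(l < p) (y + l%:R * c) ^+ r = c ^+ r * (S r).[y / c].
  rewrite horner_sum mulr_sumr; apply: eq_bigr => l _.
  by rewrite !hornerE -exprMn; congr (_ ^+ _); field.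
case: eqP => [->|/eqP rp1]; last by rewrite S_eq0 ?horner0 ?mulr0 ?oppr0 //; lia.
rewrite S_top hornerN hornerC mulrN1; congr (- _); apply: (mulfI c0).
by rewrite -exprS prednK ?prime_gt0 // cp mulr1.
Qed.

(** Beyond degree p - 1 the exponent is lowered by the equation
    (y + l c) ^ p = (y + l c) + b, which comes from l c being in the prime
    field. *)
Lemma artin_schreier_power_sum y c b r :
  c ^+ p = c -> c != 0 -> y ^+ p - y = b -> (r <= p.-1.*2)%N ->
  \sum_(l < p) (y + l%:R * c) ^+ r = - ((r == p.-1) || (r == p.-1.*2))%:R.
Proof.
move=> cp c0 yb r2; have p1 := prime_gt1 p_prime.
have [rp|pr] := ltnP r p.
  rewrite power_sum //; congr (- _%:R); congr nat_of_bool; lia.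
pose q := (r - p)%N.
rewrite (eq_bigr (fun l : 'I_p => (y + l%:R * c) ^+ q.+1 + b * (y + l%:R * c) ^+ q)); last first.
  move=> l _; rewrite -(subnK pr) -/q exprD.
  rewrite -(pFrobenius_autE charA (y + _)) rmorphD rmorphM /= pFrobenius_aut_nat.
  by rewrite !pFrobenius_autE cp -yb exprS; ring.
rewrite big_split /= -mulr_sumr !power_sum //; [|lia..].
rewrite (_ : (q == p.-1) = false) ?oppr0 ?mulr0 ?addr0; last by lia.
by congr (- _%:R); congr nat_of_bool; lia.
Qed.

End PowerSums.

(** * The trace form of an Artin-Schreier tower *)

Section ArtinSchreierStep.

Variables (K : fieldType) (F : splittingFieldType K) (p : nat).
Hypothesis charF : p \in [pchar F].
Variables (E E' : {subfield F}) (y b : F).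
Hypotheses (galE : galois E {:F}) (defE' : E' = <<E; y>>%AS).
Hypotheses (dimE' : \dim_E E' = p) (Eb : b \in E) (yb : y ^+ p - y = b).

Let sEE' : (E <= E')%VS. Proof. by rewrite defE' subv_adjoin. Qed.

(** Otherwise y would be fixed by the whole group, hence lie in E.  Two roots of
    X ^ p - X = b differ by an element of the prime field. *)
Lemma artin_schreier_gal : exists rho c,
  [/\ rho \in 'Gal({:F} / E)%g, c ^+ p = c, c != 0 & rho y = y + c].
Proof.
have p_prime := pcharf_prime charF.
have Ey : y \notin E.
  apply/negP => Ey; have := dimE'; rewrite defE' /= (Fadjoin_idP _) //.
  by rewrite divnn adim_gt0 => p1; rewrite -p1 in p_prime.
have [/existsP[rho /andP[rhoG rhoy]]|/existsPn fixy] :=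
    boolP [exists rho in 'Gal({:F} / E)%g, rho y != y].
  exists rho, (rho y - y); split; rewrite ?subr_eq0 //; last by rewrite addrC subrK.
  have rb : rho y ^+ p = rho y + (y ^+ p - y).
    apply/eqP; rewrite -subr_eq0 opprD addrA subr_eq0; apply/eqP.
    by rewrite -rmorphXn -rmorphB /= yb (fixed_gal (subvf _) rhoG Eb).
  rewrite -(pFrobenius_autE charF) rmorphB /= !pFrobenius_autE rb; ring.
case/negP: Ey; have /galois_fixedField <- := galE.
apply/fixedFieldP; first exact: memvf.
by move=> x xG; apply/eqP; have := fixy x; rewrite xG negbK.
Qed.

(** The group of F over E is the disjoint union of the cosets of the group of
    F over E' by the powers of rho, and the l-th power of rho translates y by
    l c: the trace over E is a power sum times the trace over E'. *)
Lemma artin_schreier_trace_monomial r x : galTrace E' {:F} x \in E ->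
  (r <= p.-1.*2)%N ->
  galTrace E {:F} (y ^+ r * x) =
  - ((r == p.-1) || (r == p.-1.*2))%:R * galTrace E' {:F} x.
Proof.
move=> ET r2; have [rho [c [rhoG cp c0 rhoy]]] := artin_schreier_gal.
have p_prime := pcharf_prime charF.
have galE' : galois E' {:F} by apply: galoisS galE; rewrite sEE' subvf.
have rhoX l : (rho ^+ l)%g y = y + l%:R * c.
  have [m _ cE] := prime_fieldP charF cp.
  elim: l => [|l IH]; first by rewrite expg0 gal_id mul0r addr0.
  by rewrite expgS galM ?memvf // rhoy rmorphD /= IH cE rmorph_nat -natr1; ring.
have sG := galS {:F} sEE'.
pose f (u : gal_of {:F} * 'I_p) := (u.1 * rho ^+ u.2)%g.
pose D := [set u : gal_of {:F} * 'I_p | u.1 \in 'Gal({:F} / E')%g].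
have yE' : y \in E' by rewrite defE' memv_adjoin.
have fy u : u \in D -> f u y = y + u.2%:R * c.
  by rewrite inE => uG; rewrite /f galM ?memvf // (fixed_gal (subvf _) uG yE') rhoX.
have f_inj : {in D &, injective f}.
  move=> u u' Du Du' e; have := congr1 (fun g : gal_of {:F} => g y) e.
  rewrite !fy // => /addrI/(mulIf c0)/(natf_inj_pchar charF).
  move=> /(_ (ltn_ord _) (ltn_ord _))/val_inj e2.
  by move: e; rewrite /f e2 => /mulIg e1; case: u u' e1 e2 {Du Du'} => ? ? [? ?] /= -> ->.
(* f is injective between sets of the same cardinality *)
have fD : f @: D = 'Gal({:F} / E)%g.
  apply/eqP; rewrite eqEcard; apply/andP; split.
    apply/fintype.subsetP => _ /imsetP[u + ->]; rewrite inE => uG.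
    rewrite /f groupM ?groupX //; exact: (fintype.subsetP sG).
  rewrite card_in_imset //.
  have -> : #|D| = (#|'Gal({:F} / E')%g| * p)%N.
    rewrite -[p in RHS]card_ord -[#|'I_p|]cardsT -cardsX; apply: eq_card => u.
    by case: u => g l; rewrite finset.in_setX finset.in_setT andbT !inE.
  rewrite -!galois_dim // -dimE' mulnC.
  by rewrite muln_divA ?field_dimS ?subvf // divn_mulAC ?field_dimS // divnAC mulKn ?adim_gt0.
rewrite {1}/galTrace -fD big_imset //=.
rewrite (eq_bigl (fun u => (u.1 \in 'Gal({:F} / E')%g) && true)); last first.
  by move=> u; rewrite inE andbT.
rewrite -(pair_big (fun g => g \in 'Gal({:F} / E')%g) xpredT
  (fun g (l : 'I_p) => (g * rho ^+ l)%g (y ^+ r * x))) /= exchange_big /=.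
rewrite -(artin_schreier_power_sum charF cp c0 yb r2) mulr_suml.
apply: eq_bigr => l _; rewrite -rhoX -rmorphXn.
have rhoT : (rho ^+ l)%g (galTrace E' {:F} x) = galTrace E' {:F} x.
  by rewrite (fixed_gal (subvf _) _ ET) // groupX.
rewrite -rhoT -rmorphM /galTrace /= mulr_sumr rmorph_sum; apply: eq_bigr => g gG.
rewrite galM ?memvf //; congr ((rho ^+ l)%g _).
by rewrite rmorphM rmorphXn /= (fixed_gal (subvf _) gG yE').
Qed.

(** The basis dual to 1, y, ..., y ^ (p-1) for the trace, up to sign.  The
    correction for d = 0 removes the second exponent 2 (p - 1) at which power
    sums do not vanish; it is reached for a = p - 1 only. *)
Lemma artin_schreier_trace_dual a d x : galTrace E' {:F} x \in E ->
  (a < p)%N -> (d < p)%N ->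
  galTrace E {:F} (y ^+ a * (y ^+ (p.-1 - d) - (d == 0)%N%:R) * x) =
  - (a == d)%:R * galTrace E' {:F} x.
Proof.
move=> ET ap dp; have p1 := prime_gt1 (pcharf_prime charF).
have -> : y ^+ a * (y ^+ (p.-1 - d) - (d == 0)%N%:R) * x =
  y ^+ (a + (p.-1 - d)) * x - (if d == 0%N then y ^+ a * x else 0).
  by case: eqP => _; rewrite exprD /=; ring.
rewrite raddfB /= artin_schreier_trace_monomial //; last by lia.
case: (eqVneq d 0%N) => [->|d0].
  rewrite artin_schreier_trace_monomial //; last by lia.
  rewrite -mulrBl; congr (_ * _); rewrite subn0.
  rewrite (_ : (a + p.-1 == p.-1)%N = (a == 0)%N); last by lia.
  rewrite (_ : (a + p.-1 == p.-1.*2)%N = (a == p.-1)%N); last by lia.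
  rewrite (_ : (a == p.-1.*2)%N = false) ?orbF; last by lia.
  have [->|a0] := eqVneq a 0%N; last by rewrite opprK addNr oppr0.
  by rewrite (_ : (0 == p.-1)%N = false)  ?mulr0n ?oppr0 ?subr0 ?addr0 //; lia.
rewrite raddf0 subr0; congr (- (nat_of_bool _)%:R * _); lia.
Qed.

End ArtinSchreierStep.

Section Tower.

Variables (K : fieldType) (F : splittingFieldType K) (p n : nat).
Hypothesis charF : p \in [pchar F].
Variables (L : nat -> {subfield F}) (y B : nat -> F).
Hypothesis galF : galois 1%AS {:F}%AS.
Hypotheses (L0 : L 0%N = 1%AS) (Ln : L n = {:F}%AS).
Hypothesis Lstep : forall j, (j < n)%N -> (L j <= L j.+1)%VS /\ \dim_(L j) (L j.+1) = p.
Hypothesis Ly : forall j, (1 <= j <= n)%N ->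
  [/\ L j = <<L j.-1; y j>>%AS, B j \in L j.-1 & y j ^+ p - y j = B j].

Lemma tower_galois j : (j <= n)%N -> galois (L j) {:F}.
Proof. by move=> jn; apply: galoisS galF; rewrite sub1v subvf. Qed.

Lemma tower_gal j : (1 <= j <= n)%N -> exists rho c,
  [/\ rho \in 'Gal({:F} / L j.-1)%g, c ^+ p = c, c != 0 & rho (y j) = y j + c].
Proof.
move=> jn; have [defL BL yB] := Ly jn; case/andP: jn => j0 jn.
have jn' : (j.-1 < n)%N by rewrite prednK.
have [_ dimL] := Lstep jn'; rewrite prednK // in dimL.
exact: (artin_schreier_gal charF (tower_galois (ltnW jn')) defL dimL BL yB).
Qed.

(** The trace of F over L_j is computed from the top of the tower down, one
    step at a time; each partial trace is a sign or zero, hence lies in the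
    field below. *)
Lemma tower_trace_dual (a d : nat -> nat) j :
  (forall i, (a i < p)%N /\ (d i < p)%N) -> (j <= n)%N ->
  galTrace (L j) {:F}
    (\prod_(j.+1 <= i < n.+1)
       (y i ^+ a i * (y i ^+ (p.-1 - d i) - (d i == 0)%N%:R))) =
  \prod_(j.+1 <= i < n.+1) - (a i == d i)%:R.
Proof.
move=> adp jn; rewrite -(subKn jn).
elim: (n - j)%N (leq_subr j n) => {j jn} [|e IH] en.
  rewrite subn0 !big_geq // Ln /galTrace (eq_bigr (fun=> 1)) => [|x _]; last exact: rmorph1.
  rewrite sumr_const -galois_dim ?divnn ?adim_gt0 //.
  by apply: galoisS galF; rewrite sub1v subvv.
set j := (n - e.+1)%N; have jE : (n - e)%N = j.+1 by rewrite /j; lia.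
have jn : (j < n)%N by rewrite /j; lia.
have {IH} := IH (ltnW en); rewrite jE => IH.
have [defL BL yB] := Ly (j := j.+1) jn; have [_ dimL] := Lstep jn.
rewrite [in LHS]big_ltn // [RHS]big_ltn // -IH.
have [ap dp] := adp j.+1.
apply: (artin_schreier_trace_dual charF (tower_galois (ltnW jn)) defL dimL BL yB) => //.
by rewrite IH; apply: rpred_prod => i _; rewrite rpredN rpred_nat.
Qed.

End Tower.

(** * Digit sums weighted by the conductors *)

Section Digits.

Variable p : nat.
Hypothesis p_gt0 : (0 < p)%N.

Lemma digit_lt m j : (digit p m j < p)%N.
Proof. by rewrite ltn_mod. Qed.

Lemma digit1 m : digit p m 1 = (m %% p)%N.
Proof. by rewrite /digit expn0 divn1. Qed.

Lemma digitS m j : digit p m j.+2 = digit p (m %/ p) j.+1.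
Proof. by rewrite /digit /= expnS divnMA. Qed.

Lemma digit_inj n m m' : (m < p ^ n)%N -> (m' < p ^ n)%N ->
  (forall j, (1 <= j <= n)%N -> digit p m j = digit p m' j) -> m = m'.
Proof.
elim: n m m' => [|n IH] m m'; first by rewrite expn0 !ltnS !leqn0 => /eqP -> /eqP ->.
rewrite expnSr => mp mp' e; rewrite (divn_eq m p) (divn_eq m' p) -!digit1 e //.
congr (_ * _ + _)%N; apply: IH; rewrite ?ltn_divLR // => j /andP[j1 jn].
by case: j j1 jn => // j _ jn; rewrite -!digitS e.
Qed.

Lemma digit_compl n m j : (m < p ^ n)%N -> (1 <= j <= n)%N ->
  digit p ((p ^ n).-1 - m) j = (p.-1 - digit p m j)%N.
Proof.
elim: n m j => [|n IH] m j mp /andP[j1 jn]; first by case: j j1 jn.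
have pn : (0 < p ^ n)%N by rewrite expn_gt0 p_gt0.
have mq : (m %/ p < p ^ n)%N by rewrite ltn_divLR // -expnSr.
have mE := divn_eq m p; have rp := ltn_pmod m p_gt0.
set q := (m %/ p)%N in mE mq; set r := (m %% p)%N in mE rp.
have -> : ((p ^ n.+1).-1 - m = ((p ^ n).-1 - q) * p + (p.-1 - r))%N.
  by rewrite expnSr mE; nia.
have rp' : (p.-1 - r < p)%N by lia.
case: j j1 jn => [//|[|j]] _ jn.
  by rewrite !digit1 modnMDl modn_small.
rewrite !digitS divnMDl // (divn_small rp') addn0 IH //.
Qed.

Variable lam : nat -> nat.

(** The order of the pole of w_m at a ramified point, with conductors lam. *)
Definition pole_order n m : nat :=
  \sum_(1 <= j < n.+1) digit p m j * lam j * p ^ (n - j).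

Lemma pole_order0 n : pole_order n 0 = 0%N.
Proof.
by rewrite /pole_order big1 // => j _; rewrite /digit div0n mod0n !mul0n.
Qed.

(** Modulo p only the last term survives, and it determines the last digit
    because its weight is prime to p; the rest is divisible by p. *)
Lemma weighted_digits_inj n (a d : nat -> nat) :
  (forall j, (1 <= j <= n)%N -> coprime (lam j) p) ->
  (forall j, (a j < p)%N /\ (d j < p)%N) ->
  \sum_(1 <= j < n.+1) a j * lam j * p ^ (n - j) =
  \sum_(1 <= j < n.+1) d j * lam j * p ^ (n - j) %[mod p ^ n] ->
  forall j, (1 <= j <= n)%N -> a j = d j.
Proof.
elim: n => [|n IH] lam_p adp e j /andP[j1 jn]; first by case: j j1 jn.
have split_last (f : nat -> nat) : (\sum_(1 <= j < n.+2) f j * lam j * p ^ (n.+1 - j) =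
    (\sum_(1 <= j < n.+1) f j * lam j * p ^ (n - j)) * p + f n.+1 * lam n.+1)%N.
  rewrite big_nat_recr //= subnn expn0 muln1 big_distrl /=; congr (_ + _)%N.
  apply: eq_big_nat => i /andP[_ iN]; rewrite subSn // expnSr; ring.
rewrite !split_last in e.
have last : a n.+1 = d n.+1.
  have [alt dlt] := adp n.+1.
  have : (a n.+1 * lam n.+1 = d n.+1 * lam n.+1 %[mod p])%N.
    have := congr1 (fun m => m %% p)%N e.
    by rewrite /= !modn_dvdm ?expnS ?dvdn_mulr // !modnMDl.
  move=> h; have lp : coprime p (lam n.+1) by rewrite coprime_sym lam_p // leqnn.
  clear IH; wlog : a d alt dlt h {adp e split_last} / (d n.+1 <= a n.+1)%N => [th|le_da].
    by case: (leqP (d n.+1) (a n.+1)) => [|/ltnW] le; [|apply/esym]; apply: th.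
  move/eqP: h; rewrite eqn_mod_dvd ?leq_mul // -mulnBl Gauss_dvdl // => /dvdn_leq.
  by move=> h; apply/eqP; rewrite eqn_leq le_da andbT -subn_eq0 -leqn0 leqNgt; apply/negP => /h; lia.
move: jn; rewrite leq_eqVlt => /orP[/eqP -> //|jn].
apply: IH => //; first by move=> i /andP[i1 iN]; rewrite lam_p // i1 leqW.
move: e; rewrite last => /eqP; rewrite eqn_modDr expnSr -!muln_modl.
by rewrite eqn_pmul2r // => /eqP.
by rewrite j1.
Qed.

Lemma pole_order_inj n m m' : (forall j, (1 <= j <= n)%N -> coprime (lam j) p) ->
  (m < p ^ n)%N -> (m' < p ^ n)%N ->
  pole_order n m = pole_order n m' %[mod p ^ n] -> m = m'.
Proof.
move=> lam_p mp mp' e; apply: (@digit_inj n) => // j jn.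
apply: (weighted_digits_inj (a := digit p m) (d := digit p m') lam_p _ e) => //.
by move=> i; rewrite !digit_lt.
Qed.

(** An injection of a finite set of size p ^ n into the residues modulo p ^ n is
    onto. *)
Lemma pole_order_surj n (a : nat) :
  (forall j, (1 <= j <= n)%N -> coprime (lam j) p) ->
  exists2 m, (m < p ^ n)%N & pole_order n m = a %[mod p ^ n].
Proof.
move=> lam_p; have pn : (0 < p ^ n)%N by rewrite expn_gt0 p_gt0.
pose f (m : 'I_(p ^ n)) := Ordinal (ltn_pmod (pole_order n m) pn).
have f_inj : injective f.
  by move=> m m' [e]; apply: val_inj; exact: (pole_order_inj lam_p (ltn_ord m) (ltn_ord m') e).
have [g _ fg] := injF_bij f_inj.
exists (g (Ordinal (ltn_pmod a pn))) => //.
by have := fg (Ordinal (ltn_pmod a pn)); move=> [].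
Qed.

(** The digits of m and of p ^ n - 1 - m add up to p - 1, the digit of
    p ^ n - 1. *)
Lemma pole_order_compl n m : (m < p ^ n)%N ->
  (pole_order n ((p ^ n).-1 - m) + pole_order n m = pole_order n (p ^ n).-1)%N.
Proof.
move=> mp; rewrite /pole_order -big_split /=; apply: eq_big_nat => j /andP[j1 jn].
have pn : (0 < p ^ n)%N by rewrite expn_gt0 p_gt0.
rewrite -[(p ^ n).-1 in RHS]subn0 !digit_compl ?j1 //.
rewrite -mulnDl -mulnDl [digit p 0 j]/digit div0n mod0n subn0 subnK //.
by have := digit_lt m j; lia.
Qed.

End Digits.

(** * Zeros of nonconstant functions *)

Section RiemannRochSpaces.

Variables (k : closedFieldType) (F : splittingFieldType {fraction {poly k}}).
Implicit Types (f z : F) (D : divisor F) (P : place F).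

Lemma placeP P : is_place {:F} (val P).
Proof. by apply/asboolP; exact: (valP P). Qed.

Lemma rr_spaceP D f : rr_space D f <-> forall P, vge (val P) (- D P) f.
Proof.
split=> [[->|Df] P|Df]; first exact: vge0.
  by rewrite /vge -subr_ge0 opprK Df orbT.
have [->|f0] := eqVneq f 0; [by left|right=> P].
by have := Df P; rewrite vgeE // -subr_ge0 opprK.
Qed.

Definition add_place D P : divisor F := [fsfun D with P |-> D P + 1].

Lemma add_placeE D P P' : add_place D P P' = D P' + (P' == P)%:Z.
Proof. by rewrite fsfun_withE; case: eqP => [->|_]; rewrite ?addr0. Qed.

Lemma deg_div_sub D (S : {fset place F}) : (finsupp D `<=` S)%fset ->
  deg_div D = \sum_(P <- S) D P.
Proof.
by move=> DS; apply: big_fset_incl => // P _ /fsfun_dflt.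
Qed.

Lemma deg_add_place D P : deg_div (add_place D P) = deg_div D + 1.
Proof.
pose S := (P |` (finsupp D `|` finsupp (add_place D P)))%fset.
have PS : P \in S by rewrite fset1U1.
rewrite !(@deg_div_sub _ S).
- rewrite (eq_bigr (fun P' => D P' + (P' == P)%:Z)) => [|P' _]; last exact: add_placeE.
  rewrite big_split /=; congr (_ + _).
  rewrite (big_fsetD1 P) //= eqxx big1_fset ?addr0 // => P' P'S _.
  by move: P'S; rewrite in_fsetD1 => /andP[/negPf->].
- by apply/fsubsetP => P' DP'; rewrite !inE DP' !orbT.
- by apply/fsubsetP => P' DP'; rewrite !inE DP' !orbT.
Qed.

(** The second clause says that the residue field is k. *)
Definition rational_place (v : F -> int) :=
  is_place {:F} v /\ forall z, vge v 0 z -> exists c, vge v 1 (z - const_in F c).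

(** If the divisor D attaining the genus g has l(D) = 0, then deg D = g - 1, and
    adding a rational point gives a divisor D' of degree g; here l(D') = 0 is
    impossible because deg D' - l(D') + 1 is at most g.  The dimension grows by
    at most one, so l(D') = 1. *)
Lemma rr_positive_dim g v : genus F g -> rational_place v ->
  exists D d, rr_dim D d.+1.
Proof.
move=> [[D [[|d] [[b [bD b_free b_span]]]]] Dg gmax] [Pv resv]; last first.
  by exists D, d, b.
have {b b_free bD} b_span f : rr_space D f -> f = 0.
  by move=> /b_span[c ->]; rewrite big_ord0.
have vplace : `[< is_place {:F} v >] by apply/asboolP.
pose P : place F := exist _ v vplace; pose D' := add_place D P.
have sDD' P' f : P' != P -> vge (val P') (- D' P') f -> vge (val P') (- D P') f.
  by move=> /negPf P'P; rewrite add_placeE P'P addr0.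
have D'P : - D' P = - D P - 1 by rewrite add_placeE eqxx opprD.
(* L(D') = 0 would make deg D' + 1 exceed the genus *)
have [|/existsNP[f0 /not_implyP[Df0 /eqP f00]]] := pselect (forall f, rr_space D' f -> f = 0).
  move=> D'0; have : rr_dim D' 0.
    exists (fun=> 0); split=> [[]//|c _ []//|f /D'0 ->].
    by exists (fun=> 0); rewrite big_ord0.
  by move=> /gmax; rewrite deg_add_place; lia.
move: (Df0) => /rr_spaceP Df0v.
(* otherwise f0 would lie in L(D) = 0 *)
have vf0 : v f0 = - D P - 1.
  have := Df0v P; rewrite vgeE // D'P /= => vf0.
  apply/eqP; rewrite eq_le vf0 andbT leNgt; apply/negP => lt_f0.
  case/eqP: (f00); apply: b_span; apply/rr_spaceP => P'.
  have [->|P'P] := eqVneq P' P; last exact: sDD'.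
  by rewrite vgeE //=; move: lt_f0; rewrite -lezD1 subrK.
exists D', 0%N, (fun=> f0); split=> // [c|f /rr_spaceP Df].
  rewrite big_ord1 => /eqP; rewrite mulf_eq0 (negPf f00) orbF const_in_eq0.
  by move=> /eqP c0 i; rewrite ord1.
have [|c fc] := resv (f / f0).
  have := Df P; have [->|f_neq0] := eqVneq f 0; first by rewrite mul0r !vge0.
  rewrite !vgeE ?mulf_neq0 ?invr_eq0 // (place_div Pv) ?memvf //= D'P vf0.
  by rewrite subr_ge0.
exists (fun=> c); rewrite big_ord1; apply/eqP; rewrite -subr_eq0; apply/eqP.
apply: b_span; apply/rr_spaceP => P'; have Pl := placeP P'.
have [->|P'P] := eqVneq P' P; last first.
  apply: sDD' => //; rewrite (vgeB Pl) ?memvf ?Df //.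
  by rewrite -[- _]add0r (vgeM Pl) ?memvf ?Df0v ?(vge_const Pl).
have -> : f - const_in F c * f0 = (f / f0 - const_in F c) * f0.
  by rewrite mulrBl divfK.
have -> : - D P = 1 + v f0 by rewrite vf0; lia.
by rewrite (vgeM Pv) ?memvf // /vge lexx orbT.
Qed.

Lemma algebraic_const (q : {poly k}) z : q != 0 ->
  root (map_poly (const_in F) q) z -> exists c, z = const_in F c.
Proof.
move=> q0; have [r ->] := closed_field_poly_normal q.
rewrite /root map_polyZ hornerZ mulf_eq0 fmorph_eq0 lead_coef_eq0 (negPf q0) /=.
rewrite rmorph_prod horner_prod prodf_seq_eq0 => /hasP[c _] /=.
rewrite rmorphB /= map_polyX map_polyC !hornerE subr_eq0 => /eqP ->.
by exists c.
Qed.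

(** If z had no zero, z^-1 would have no pole, and multiplication by z^-1 would
    act on the finite-dimensional nonzero space L(D).  The powers of z^-1 would
    be linearly dependent over k, making z^-1 algebraic over k, hence
    constant. *)
Lemma nonconstant_zero g v z : genus F g -> rational_place v ->
  (forall c, z <> const_in F c) -> exists2 w, is_place {:F} w & 0 < w z.
Proof.
move=> gF ratv z_nonconst; apply: contrapT => no_zero.
have z0 : z != 0 by apply/eqP => z0; apply: (z_nonconst 0); rewrite rmorph0.
have [D [d [b [bD b_free b_span]]]] := rr_positive_dim gF ratv.
pose f := b ord0.
have f0 : f != 0.
  apply/eqP => f0; have := b_free (fun i => (i == ord0)%:R).
  rewrite (bigD1 ord0) //= big1 => [|i /negPf ->]; last by rewrite rmorph0 mul0r.
  rewrite -/f f0 mulr0 addr0 => /(_ erefl ord0) /eqP; by rewrite oner_eq0.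
have Dzf r : rr_space D (z^-1 ^+ r * f).
  apply/rr_spaceP => P; have PP := placeP P.
  rewrite -[- _]add0r (vgeM PP) ?memvf //; last by have /rr_spaceP := bD ord0; apply.
  rewrite (vgeX PP) ?memvf // vgeE ?invr_eq0 // (placeV PP) ?memvf // oppr_ge0 leNgt.
  by apply/negP => zP; apply: no_zero; exists (val P).
have [c cE] := fin_all_exists (fun r : 'I_d.+2 => b_span _ (Dzf r)).
(* d + 2 functions z ^ -r f in a space of dimension d + 1 *)
pose C := \matrix_(r < d.+2, j < d.+1) c r j.
have [u uC u0] : exists2 u : 'rV_d.+2, u *m C = 0 & u != 0.
  have : kermx C != 0.
    by rewrite -mxrank_eq0 mxrank_ker subn_eq0 -ltnNge ltnS rank_leq_col.
  by case/rowV0Pn=> u /sub_kermxP uC u0; exists u.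
pose q : {poly k} := \poly_(r < d.+2) u 0 (inord r).
have q0 : q != 0.
  apply: contraNneq u0 => q0; apply/eqP/rowP => r; rewrite mxE.
  have := congr1 (fun p : {poly k} => p`_r) q0.
  by rewrite coef_poly ltn_ord coef0 inord_val.
have [|e ze] := @algebraic_const q z^-1 q0.
  rewrite /root; suff : (map_poly (const_in F) q).[z^-1] * f = 0.
    by move/eqP; rewrite mulf_eq0 (negPf f0) orbF.
  rewrite /q poly_def rmorph_sum horner_sum mulr_suml.
  rewrite (eq_bigr (fun r : 'I_d.+2 => \sum_j const_in F (u 0 r * C r j) * b j)).
    rewrite exchange_big big1 //= => j _.
    have := congr1 (fun A : 'rV_d.+1 => A 0 j) uC; rewrite !mxE => s0.
    by rewrite -mulr_suml -rmorph_sum s0 rmorph0 mul0r.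
  move=> r _ /=; rewrite map_polyZ map_polyXn hornerZ hornerXn inord_val -mulrA cE.
  by rewrite mulr_sumr; apply: eq_bigr => j _; rewrite mxE rmorphM mulrA.
apply: (z_nonconst e^-1); rewrite fmorphV /= -ze invrK //.
Qed.

End RiemannRochSpaces.

(** * Rational functions and places *)

Section PolynomialDegree.

Variable k : closedFieldType.
Implicit Types (q n d : {poly k}).

Lemma roots_of q : q != 0 -> exists r : seq k,
  (size q).-1 = size r /\ forall b, mup b q = count_mem b r.
Proof.
move=> q0; have [r qE] := closed_field_poly_normal q; exists r.
have lc0 : lead_coef q != 0 by rewrite lead_coef_eq0.
split; first by rewrite qE size_scale // size_prod_XsubC.
move=> b; rewrite {1}qE -mul_polyC mupMr ?mu_prod_XsubC //.
by rewrite /root hornerC.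
Qed.

Lemma sum_count_mem (r S : seq k) : uniq S -> {subset r <= S} ->
  (\sum_(b <- S) count_mem b r = size r)%N.
Proof.
move=> uS; elim: r => [|x r IH] rS; first by rewrite big1.
rewrite /= big_split /= IH => [|b br]; last by rewrite rS // inE br orbT.
rewrite (bigD1_seq x) ?rS ?mem_head //= eqxx big1 ?addn0 // => b /negPf.
by rewrite eq_sym => ->.
Qed.

(** Over an algebraically closed field the degree is the number of roots with
    multiplicity.  The list S is completed by the remaining roots of n and d. *)
Lemma degree_mup (S : seq k) n d : n != 0 -> d != 0 -> uniq S ->
  exists S', [/\ uniq (S ++ S'), {in S', forall b, b \notin S} &
   (size n).-1%:Z - (size d).-1%:Z =
   \sum_(b <- S ++ S') ((mup b n)%:Z - (mup b d)%:Z)].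
Proof.
move=> n0 d0 uS; have [rn [-> rnE]] := roots_of n0; have [rd [-> rdE]] := roots_of d0.
pose S' := [seq b <- undup (rn ++ rd) | b \notin S].
have S'S : {in S', forall b, b \notin S} by move=> b; rewrite mem_filter => /andP[].
have uSS' : uniq (S ++ S').
  rewrite cat_uniq uS filter_uniq ?undup_uniq // andbT.
  by apply/hasPn => b /S'S.
have sub b : b \in rn ++ rd -> b \in S ++ S'.
  by move=> br; rewrite mem_cat mem_filter mem_undup br andbT orbN.
have sumE q r : (forall b, mup b q = count_mem b r) -> {subset r <= rn ++ rd} ->
    \sum_(b <- S ++ S') (mup b q)%:Z = (size r)%:Z.
  move=> qr rS; rewrite -(big_morph Posz PoszD (erefl 0%:Z)); congr Posz.
  rewrite -(@sum_count_mem r _ uSS') => [|b /rS/sub //].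
  by apply: eq_bigr => b _; rewrite qr.
exists S'; split=> //; rewrite big_split /= sumrN (sumE n rn) ?(sumE d rd) //.
- by move=> b br; rewrite mem_cat br orbT.
- by move=> b br; rewrite mem_cat br.
Qed.

(** The orders of a nonzero rational function add up to its degree n - d, which
    is minus its order at infinity; here they are nonnegative outside the
    alpha_l and at infinity. *)
Lemma regular_function_degree s (alpha : 'I_s -> k) (e : 'I_s -> int) n d :
  injective alpha -> n != 0 -> d != 0 ->
  (forall l, e l <= (mup (alpha l) n)%:Z - (mup (alpha l) d)%:Z) ->
  (forall b, (forall l, b <> alpha l) -> (mup b d <= mup b n)%N) ->
  (size n <= size d)%N -> \sum_l e l <= 0.
Proof.
move=> alpha_inj n0 d0 e_le reg sz.
have uS : uniq (codom alpha) by apply/injectiveP.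
have [S' [_ S'S]] := degree_mup n0 d0 uS.
rewrite big_cat /= [X in _ = X + _]big_map big_enum /= => degE.
apply: le_trans (_ : \sum_l ((mup (alpha l) n)%:Z - (mup (alpha l) d)%:Z) <= 0).
  exact: ler_sum.
move: degE; set A := (X in _ = X + _ -> _); set B := (X in _ = _ + X -> _) => degE.
have B0 : 0 <= B.
  rewrite /B big_seq sumr_ge0 // => b /S'S /codomP nb; rewrite subr_ge0 lez_nat reg //.
  by move=> l bl; apply: nb; exists l.
have : (size n).-1%:Z - (size d).-1%:Z <= 0 by rewrite subr_le0 lez_nat -!subn1 leq_sub2r.
by rewrite degE -/A; lia.
Qed.

End PolynomialDegree.

Section PlacesOnRationalFunctions.

Variables (k : closedFieldType) (F : splittingFieldType {fraction {poly k}}).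
Variable w : F -> int.
Hypothesis Pw : is_place {:F} w.

Lemma vge_poly_in q : vge w 0 (poly_in F 'X) -> vge w 0 (poly_in F q).
Proof.
move=> wX; elim/poly_ind: q => [|q c IH]; first by rewrite rmorph0 vge0.
rewrite rmorphD rmorphM (vgeD Pw) ?memvf ?(vge_const Pw) //.
by rewrite -[0]addr0 (vgeM Pw) ?memvf.
Qed.

(** A polynomial that does not vanish at b is a nonzero constant plus a multiple
    of X - b, so it is a unit at w. *)
Lemma place_at_finite b q : 0 < w (poly_in F ('X - b%:P)) -> q != 0 ->
  w (poly_in F q) = w (poly_in F ('X - b%:P)) * (mup b q)%:Z.
Proof.
move=> wb q0; have pXb : poly_in F ('X - b%:P) != 0 by rewrite poly_in_eq0 polyXsubC_eq0.
have wX : vge w 0 (poly_in F 'X).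
  rewrite -['X](subrK b%:P) rmorphD (vgeD Pw) ?memvf ?(vge_const Pw) //.
  by rewrite vgeE // ltW.
have [m [r /[!q0]/= rb qE]] := multiplicity_XsubC q b.
rewrite qE mupMr // mup_XsubCX eqxx rmorphM rmorphXn /=.
have r0 : r != 0 by apply: contraNneq rb => ->; rewrite root0.
rewrite (placeM Pw) ?memvf ?expf_neq0 ?poly_in_eq0 ?polyXsubC_eq0 // (placeX Pw) ?memvf //.
suff -> : w (poly_in F r) = 0 by rewrite add0r mulrC.
have [r' rE] : exists r', r - (r.[b])%:P = r' * ('X - b%:P).
  by apply/factor_theorem; rewrite /root hornerD hornerN hornerC subrr.
rewrite -[r](subrK (r.[b])%:P) rE addrC rmorphD rmorphM /=.
have rb0 : const_in F r.[b] != 0 by rewrite const_in_eq0.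
have [||||_ ->] := @place_dominant _ _ _ w Pw (const_in F r.[b])
    (poly_in F r' * poly_in F ('X - b%:P)); rewrite ?memvf //.
  rewrite (place_const Pw); apply: (vgeM Pw (memvf _) (memvf _)).
    exact: vge_poly_in.
  by rewrite /vge -gtz0_ge1 wb orbT.
exact: (place_const Pw).
Qed.

(** At a pole of X the monomial of highest degree dominates. *)
Lemma place_at_infinity q : w (poly_in F 'X) < 0 -> q != 0 ->
  w (poly_in F q) = (size q).-1%:Z * w (poly_in F 'X).
Proof.
move=> wX; elim/poly_ind: q => [|q c IH]; first by rewrite eqxx.
have pX : poly_in F 'X != 0 by rewrite poly_in_eq0 polyX_eq0.
have [-> |q0 _] := eqVneq q 0.
  rewrite mul0r add0r polyC_eq0 => c0.
  by rewrite size_polyC c0 mul0r; apply: (place_const Pw).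
have wqX : w (poly_in F (q * 'X)) = (size q)%:Z * w (poly_in F 'X).
  rewrite rmorphM (placeM Pw) ?memvf ?poly_in_eq0 ?polyX_eq0 // IH //.
  by rewrite [in RHS](polySpred q0) intS mulrDl mul1r addrC.
have qX0 : q * 'X != 0 by rewrite mulf_neq0 ?polyX_eq0.
rewrite size_MXaddC (negPf q0) /= rmorphD.
have [||||_ ->] := @place_dominant _ _ _ w Pw (poly_in F (q * 'X)) (poly_in F c%:P);
  rewrite ?memvf ?poly_in_eq0 //.
rewrite -[poly_in F c%:P]/(const_in F c); apply: vge_le (vge_const Pw c).
by rewrite wqX; have := size_poly_gt0 q; rewrite q0; nia.
Qed.

(** The restriction to E has value group e Z, where e is its least positive
    value.  Such a value exists: on E the restriction cannot be trivial, since
    every element of F is integral over E. *)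
Lemma place_restriction (E : {subfield F}) : exists (e : nat) Q,
  [/\ (0 < e)%N, is_place E Q & forall z, z \in E -> w z = e%:Z * Q z].
Proof.
have nontriv : exists n : nat, `[< exists2 z, z \in E & w z = n.+1%:Z >].
  apply: contrapT => triv.
  have wE z : z \in E -> vge w 0 z.
    move=> Ez; apply/negPn/negP; rewrite /vge negb_or -ltNge => /andP[z0 wz].
    apply: triv; exists (`|w z|.-1)%N; apply/asboolP; exists z^-1; first by rewrite rpredV.
    by rewrite (placeV Pw) ?memvf //; lia.
  have [t _ wt] := place_onto Pw.
  have t0 : t != 0 by apply: contra_eqN wt => /eqP ->; rewrite (place0 Pw).
  have : vge w 0 t^-1.
    apply: (vge_root Pw (monic_minPoly E t^-1)); rewrite ?memvf ?root_minPoly //.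
      by apply/polyOverP => i; rewrite memvf.
    by move=> i; apply: wE; exact: (polyOverP (minPolyOver E t^-1) i).
  by rewrite vgeE ?invr_eq0 // (placeV Pw) ?memvf // wt.
case: (ex_minnP nontriv) => n /asboolP[u Eu wu] n_min.
have u0 : u != 0 by apply: contra_eqN wu => /eqP ->; rewrite (place0 Pw).
have wE z : z \in E -> w z = n.+1%:Z * (w z %/ n.+1%:Z)%Z.
  move=> Ez; have [->|z0] := eqVneq z 0; first by rewrite (place0 Pw) div0z mulr0.
  have zE := divz_eq (w z) n.+1%:Z; have r_ge := modz_ge0 (w z) (isT : n.+1%:Z != 0).
  have r_lt := ltz_pmod (w z) (isT : 0 < n.+1%:Z).
  suff r0 : (w z %% n.+1%:Z)%Z = 0 by rewrite {1}zE r0 addr0 mulrC.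
  apply/eqP/negPn/negP => r0.
  have Eq : u ^ (w z %/ n.+1%:Z)%Z \in E by rewrite rpredXz.
  suff : (n <= `|(w z %% n.+1%:Z)%Z|.-1)%N by lia.
  apply: n_min; apply/asboolP; exists (z / u ^ (w z %/ n.+1%:Z)%Z); first by rewrite rpred_div.
  rewrite (place_div Pw) ?memvf ?expfz_neq0 // (placeZ Pw) ?memvf // wu.
  by move: zE r0 r_ge; gen_vals w; lia.
pose Q z := if z \in E then (w z %/ n.+1%:Z)%Z else 0.
have wQ z : z \in E -> w z = n.+1%:Z * Q z by move=> Ez; rewrite /Q Ez -wE.
have nI (a b : int) : n.+1%:Z * a = n.+1%:Z * b -> a = b by move/mulfI; apply.
exists n.+1, Q; split=> //; split.
- by apply: nI; rewrite -wQ ?rpred0 // (place0 Pw) mulr0.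
- by move=> z; rewrite /Q => /negPf ->.
- by move=> c; apply: nI; rewrite -wQ ?const_in_mem // (place_const Pw) mulr0.
- move=> a b Ea Eb a0 b0; apply: nI; rewrite mulrDr -!wQ ?rpredM //.
  by rewrite (placeM Pw) ?memvf.
- move=> a b Ea Eb a0 b0 ab0.
  have := placeD Pw (memvf a) (memvf b) a0 b0 ab0.
  by rewrite !ge_min !wQ ?rpredD // !ler_pM2l.
- by exists u => //; apply: nI; rewrite -wQ // wu mulr1.
Qed.

End PlacesOnRationalFunctions.

(** * Values of the generators at a totally ramified place *)

Section RamifiedTower.

Variables (k : closedFieldType) (F : splittingFieldType {fraction {poly k}}).
Variables (p n : nat).
Hypotheses (charF : p \in [pchar F]) (galF : galois 1%AS {:F}%AS).
Hypothesis dimF : \dim {:F} = (p ^ n)%N.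
Variables (L : nat -> {subfield F}) (P : nat -> F -> int) (y B : nat -> F).
Variables (lam : nat -> nat) (alpha : k).
Hypotheses (Ltower : is_tower p n L) (Palpha : place_at alpha (P 0%N)).
Hypothesis Pplace : forall j, (j <= n)%N -> is_place (L j) (P j) /\ lies_over 1 (P 0%N) (P j).
Hypothesis PtotQ : totally_ramified 1%AS (P 0%N).
Hypothesis Ly : forall j, (1 <= j <= n)%N ->
  [/\ L j = <<L j.-1; y j>>%AS, B j \in L j.-1 & y j ^+ p - y j = B j].
Hypothesis lamE : forall j, (1 <= j <= n)%N -> (lam j)%:Z = - P j.-1 (B j).
Hypothesis lam_cop : forall j, (1 <= j <= n)%N -> lam j = 0%N \/ coprime (lam j) p.

Let v := P n.

Let p_prime : prime p. Proof. exact: pcharf_prime charF. Qed.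

Lemma top_place : is_place {:F} v.
Proof. by have [+ _] := Pplace (leqnn n); have [_ -> _] := Ltower. Qed.

Let Pv := top_place.
Let PQ : is_place 1%AS (P 0%N). Proof. by case: Palpha. Qed.

Lemma top_place_base z : z \in 1%VS -> v z = (\dim {:F})%:Z * P 0%N z.
Proof.
have [w [Pw [over wE]]] := PtotQ; rewrite dimv1 divn1 in wE.
suff -> : v = w by exact: wE.
apply: (totally_ramified_unique PQ Pw wE Pv).
by have [] := Pplace (leqnn n).
Qed.

Let vQ := top_place_base.

(** Elements of L_j of nonnegative value at v are integral over the base
    valuation ring, hence have nonnegative value at the place P j; so v
    restricts to a multiple of P j. *)
Lemma level_index j : (j <= n)%N -> exists e : nat,
  (0 < e)%N /\ forall z, z \in L j -> v z = e%:Z * P j z.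
Proof.
move=> jn; have [Pj over] := Pplace jn.
have sKL := subvP (sub1v (L j)).
have [t Lt Pt] := place_onto Pj.
have [||vt vE] := place_dominated Pv Pj _ _ Lt Pt.
- move=> z Lz /(int_closure_vge PQ Pv vQ galF)[q [mq qQ qz]].
  have qK i : q`_i \in 1%VS /\ vge (P 0%N) 0 q`_i.
    have [iq|qi] := ltnP i (size q); last by rewrite nth_default ?vge0 ?rpred0.
    move: qQ; rewrite qualifE /= => /(all_nthP 0)/(_ i iq); rewrite inE => /andP[Kq Qq].
    by rewrite /vge Qq orbT.
  apply: (vge_root Pj mq) => //.
    by apply/polyOverP => i; apply: sKL; have [] := qK i.
  by move=> i; have [Ki Qi] := qK i; apply: (lies_over_vge PQ Pj over).
- have [b Kb Qb] := place_onto PQ; exists b; first exact: sKL.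
  split; last by apply: over => //; rewrite Qb.
  by rewrite vQ // Qb mulr1 ltz_nat adim_gt0.
exists `|v t|%N; split; first by lia.
by move=> z Lz; rewrite vE // gtz0_abs.
Qed.

(** If lambda_j were zero, then y_j would have a residue a in k.  A Galois element
    moving y_j by a nonzero constant c preserves v, so that both y_j - a and
    y_j + c - a, and with them c, would vanish at v. *)
Lemma local_lambda_coprime j : (1 <= j <= n)%N -> coprime (lam j) p.
Proof.
move=> jn; have [defL BL yB] := Ly jn; case: (lam_cop jn) => // lam0.
have [rho [c [rhoG cp c0 rhoy]]] :=
  let: And3 L0 Ln Lstep := Ltower in tower_gal charF galF Lstep Ly jn.
have vB : v (B j) = 0.
  have [|e [_ eE]] := @level_index j.-1; first by case/andP: jn => _ /(leq_trans (leq_pred _)).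
  by rewrite eE // -[P _ _]opprK -lamE // lam0 oppr0 mulr0.
have vy : vge v 0 (y j).
  by apply: (artin_schreier_integral Pv p_prime _ _ yB); rewrite ?memvf // /vge vB orbT.
have [a va] := residue_const PQ Pv vQ (proj2 Palpha) vy.
have vra : vge v 1 (y j + c - const_in F a).
  have <- : rho (y j - const_in F a) = y j + c - const_in F a.
    by rewrite rmorphB /= rhoy gal_fix1 // (const_in_mem a 1%AS).
  by rewrite /vge fmorph_eq0 /= (totally_ramified_gal PQ Pv vQ).
have vc : v c = 0.
  have := placeX Pv p (memvf c) c0; rewrite cp.
  by have := prime_gt1 p_prime; nia.
have : vge v 1 c.
  have -> : c = (y j + c - const_in F a) - (y j - const_in F a) by ring.
  by rewrite (vgeB Pv) ?memvf.
by rewrite vgeE // vc.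
Qed.

(** Comparing values in y ^ p - y = B gives p e' P_(j+1)(y) = - e lambda, with lambda
    prime to p and e a multiple of e'. *)
Lemma level_index_dvd j e e' : (j < n)%N ->
  (forall z, z \in L j -> v z = e%:Z * P j z) ->
  (forall z, z \in L j.+1 -> v z = e'%:Z * P j.+1 z) -> (0 < e')%N ->
  (p * e' %| e)%N.
Proof.
move=> jn eE e'E e'0.
have j1n : (1 <= j.+1 <= n)%N by [].
have [defL BL yB] := Ly j1n; have lp := local_lambda_coprime j1n.
have [Pj _] := Pplace (ltnW jn); have [t Lt Pt] := place_onto Pj.
have sL : (L j <= L j.+1)%VS by rewrite defL subv_adjoin.
have yL : y j.+1 \in L j.+1 by rewrite defL memv_adjoin.
have et : v t = e%:Z by rewrite eE // Pt mulr1.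
have e_fe' : e%:Z = e'%:Z * P j.+1 t by rewrite -et e'E // (subvP sL).
have [f eE'] : exists f : nat, e = (e' * f)%N.
  by exists `|P j.+1 t|%N; move: e_fe'; gen_vals (P j.+1); nia.
have e0 : (0 < e)%N.
  have [|e1 [e10 e1E]] := @level_index j; first exact: ltnW.
  by have := e1E t Lt; rewrite et Pt mulr1; lia.
have lam0 : (0 < lam j.+1)%N.
  by case: (lam j.+1) lp => // /eqP; rewrite gcd0n => p1; have := prime_gt1 p_prime; lia.
have vB : v (B j.+1) = - (e * lam j.+1)%N%:Z.
  by rewrite eE // PoszM -mulrN lamE // opprK.
have := artin_schreier_pole Pv p_prime (memvf _) (memvf _) yB.
rewrite vB e'E // => yE.
have {}yE : p%:Z * (e'%:Z * P j.+1 (y j.+1)) = - (e * lam j.+1)%N%:Z by apply: yE; nia.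
have : (p%:Z %| (f * lam j.+1)%N%:Z)%Z.
  apply/dvdzP; exists (- P j.+1 (y j.+1)); apply: (@mulfI _ e'%:Z); first by lia.
  by move: yE; rewrite eE'; gen_vals (P j.+1); nia.
rewrite dvdzE /= Gauss_dvdl ?[coprime p _]coprime_sym // eE' mulnC => pf.
by rewrite dvdn_pmul2l.
Qed.

(** Each of the n steps contributes at least a factor p to the ramification
    index p ^ n of v over k(x), hence exactly p. *)
Lemma level_index_eq j e : (j <= n)%N ->
  (forall z, z \in L j -> v z = e%:Z * P j z) -> (0 < e)%N -> e = (p ^ (n - j))%N.
Proof.
have p0 := prime_gt0 p_prime.
(* p ^ i e divides p ^ n by the steps below level i, and p ^ (n - i) divides e
   by the steps above it. *)
have up i : (i <= n)%N -> exists e : nat, [/\ (0 < e)%N,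
    forall z, z \in L i -> v z = e%:Z * P i z & (p ^ i * e %| p ^ n)%N].
  elim: i => [|i IH] iN.
    exists (p ^ n)%N; split; rewrite ?expn_gt0 ?p0 ?expn0 ?mul1n //.
    by have [-> _ _] := Ltower => z Kz; rewrite vQ // dimF.
  have [e1 [e10 e1E e1d]] := IH (ltnW iN); have [e2 [e20 e2E]] := level_index iN.
  exists e2; split=> //; apply: dvdn_trans e1d.
  by rewrite expnSr -mulnA dvdn_mul // (level_index_dvd iN e1E e2E).
have down d i e1 : (i + d = n)%N -> (0 < e1)%N ->
    (forall z, z \in L i -> v z = e1%:Z * P i z) -> (p ^ d %| e1)%N.
  elim: d i e1 => [|d IH] i e1 id e10 e1E; first by rewrite expn0 dvd1n.
  have iN : (i < n)%N by lia.
  have [e2 [e20 e2E]] := level_index iN.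
  apply: dvdn_trans (level_index_dvd iN e1E e2E e20).
  by rewrite expnS dvdn_mul // (IH i.+1) //; lia.
move=> jn eE e0; have [e1 [e10 e1E e1d]] := up j jn.
have ee1 : e = e1.
  have [Pj _] := Pplace jn; have [t Lt Pt] := place_onto Pj.
  by have := eE t Lt; rewrite e1E // Pt !mulr1 => -[].
rewrite -ee1 in e1d; have := down (n - j)%N j e (subnKC jn) e0 eE.
move=> h; apply/eqP; rewrite eqn_dvd h andbT.
by rewrite -(@dvdn_pmul2l (p ^ j)) ?expn_gt0 ?p0 // -expnD subnKC.
Qed.

Lemma generator_value j : (1 <= j <= n)%N -> v (y j) = - (lam j * p ^ (n - j))%N%:Z.
Proof.
move=> jn; have [defL BL yB] := Ly jn; have lp := local_lambda_coprime jn.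
have lam0 : (0 < lam j)%N.
  by case: (lam j) lp => // /eqP; rewrite gcd0n => p1; have := prime_gt1 p_prime; lia.
have j1n : (j.-1 <= n)%N by lia.
have [e [e0 eE]] := level_index j1n.
have vB : v (B j) = - (e * lam j)%N%:Z.
  by rewrite eE // PoszM -mulrN lamE // opprK.
have := artin_schreier_pole Pv p_prime (memvf _) (memvf _) yB.
rewrite vB (level_index_eq j1n eE e0) => h.
have pn0 : (0 < p ^ (n - j.-1))%N by rewrite expn_gt0 prime_gt0.
have {h} : p%:Z * v (y j) = - (p ^ (n - j.-1) * lam j)%N%:Z by apply: h; nia.
rewrite (_ : (n - j.-1 = (n - j).+1)%N); last by lia.
rewrite expnS -mulnA PoszM -mulrN => /mulfI -> //; first by rewrite mulnC.
by have := prime_gt0 p_prime; lia.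
Qed.

End RamifiedTower.

(** * Pole numbers and the different *)

Section PoleNumbers.

Variables (k : closedFieldType) (F : splittingFieldType {fraction {poly k}}).
Variables (p n s : nat) (L : nat -> {subfield F}) (alpha : 'I_s -> k).
Variables (P : 'I_s -> nat -> F -> int) (y B : nat -> F) (lam : 'I_s -> nat -> nat).
Hypotheses (charF : p \in [pchar F]) (galF : galois 1%AS {:F}%AS).
Hypothesis dimF : \dim {:F} = (p ^ n)%N.
Hypothesis alpha_inj : injective alpha.
Hypotheses (Ltower : is_tower p n L) (Pabove : places_above n alpha L P).
Hypothesis Ptot : forall l, totally_ramified 1%AS (P l 0%N).
Hypothesis standard : standard_form p n L P y B lam.

Let N := (p ^ n)%N.
Let v l := P l n.
Let x_ (b : k) : F := poly_in F ('X - b%:P).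

Let p_prime : prime p. Proof. exact: pcharf_prime charF. Qed.
Let p_gt0 : (0 < p)%N. Proof. exact: prime_gt0. Qed.
Let N_gt0 : (0 < N)%N. Proof. by rewrite expn_gt0 p_gt0. Qed.

Let Ly j : (1 <= j <= n)%N ->
  [/\ L j = <<L j.-1; y j>>%AS, B j \in L j.-1 & y j ^+ p - y j = B j].
Proof. by case/standard=> [[]]. Qed.

Let Palpha l : place_at (alpha l) (P l 0%N).
Proof. by have [] := Pabove l. Qed.

Let Pplace l j : (j <= n)%N -> is_place (L j) (P l j) /\ lies_over 1 (P l 0%N) (P l j).
Proof. by have [_] := Pabove l; apply. Qed.

Let lamE l j : (1 <= j <= n)%N -> (lam l j)%:Z = - P l j.-1 (B j).
Proof. by case/standard=> _ + _ _; apply. Qed.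

Let lam_cop l j : (1 <= j <= n)%N -> lam l j = 0%N \/ coprime (lam l j) p.
Proof. by case/standard=> _ _ + _; apply. Qed.

Let PQ l : is_place 1%AS (P l 0%N). Proof. by case: (Palpha l). Qed.
Let Pv l : is_place {:F} (v l).
Proof. exact: (top_place Ltower (@Pplace l)). Qed.

Let vQ l z : z \in 1%VS -> v l z = (\dim {:F})%:Z * P l 0%N z.
Proof. exact: (top_place_base Ltower (Palpha l) (@Pplace l) (Ptot l)). Qed.

Lemma lambda_coprime l j : (1 <= j <= n)%N -> coprime (lam l j) p.
Proof.
exact: (local_lambda_coprime charF galF dimF Ltower (Palpha l) (@Pplace l) (Ptot l) Ly
  (@lamE l) (@lam_cop l)).
Qed.

Let vy l j : (1 <= j <= n)%N -> v l (y j) = - (lam l j * p ^ (n - j))%N%:Z.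
Proof.
exact: (generator_value charF galF dimF Ltower (Palpha l) (@Pplace l) (Ptot l) Ly
  (@lamE l) (@lam_cop l)).
Qed.

Definition basis_elt m : F := \prod_(1 <= j < n.+1) y j ^+ digit p m j.
(** Dual to [basis_elt m] for the trace, up to the sign (-1) ^ n. *)
Definition dual_elt m : F :=
  \prod_(1 <= j < n.+1) (y j ^+ (p.-1 - digit p m j) - (digit p m j == 0)%N%:R).

Let dimZ : (\dim {:F})%:Z = (p ^ n)%N%:Z. Proof. by rewrite dimF. Qed.

Notation mu l m := (pole_order p (lam l) n m).

Lemma x_value l b : v l (x_ b) = ((p ^ n) * (b == alpha l))%N%:Z.
Proof.
rewrite vQ ?(poly_in_mem _ 1%AS) // dimF (proj2 (Palpha l)) ?polyXsubC_eq0 //.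
by rewrite -['X - b%:P]expr1 mup_XsubCX PoszM; case: eqP.
Qed.

Lemma basis_elt_value l m : basis_elt m != 0 /\ v l (basis_elt m) = - (mu l m)%:Z.
Proof.
rewrite /basis_elt /pole_order.
suff [Y0 Yv] : \prod_(j <- index_iota 1 n.+1) y j ^+ digit p m j != 0 /\
   v l (\prod_(j <- index_iota 1 n.+1) y j ^+ digit p m j) =
   - (\sum_(j <- index_iota 1 n.+1) digit p m j * lam l j * p ^ (n - j))%N%:Z by [].
have : {subset index_iota 1 n.+1 <= index_iota 1 n.+1} by [].
elim: {1 3 4 5}(index_iota 1 n.+1) => [_|j r IH sub].
  by rewrite !big_nil oner_neq0 (place1 (Pv l)).
rewrite !big_cons; have [|Y0 Yv] := IH.
  by move=> i ir; apply: sub; rewrite inE ir orbT.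
have jn : (1 <= j <= n)%N by have := sub j (mem_head _ _); rewrite mem_index_iota ltnS.
have yj0 : y j != 0.
  have lam0 : (0 < lam l j)%N.
    by case: (lam l j) (lambda_coprime l jn) => // /eqP; rewrite gcd0n => p1; have := prime_gt1 p_prime; lia.
  apply: contra_eq_neq (vy l jn) => ->; rewrite (place0 (Pv l)) eq_sym oppr_eq0.
  by rewrite eqz_nat muln_eq0 expn_eq0 !eqn0Ngt lam0 p_gt0.
rewrite mulf_neq0 ?expf_neq0 //; split=> //.
rewrite (placeM (Pv l)) ?memvf ?expf_neq0 // Yv (placeX (Pv l)) ?memvf // vy //.
by rewrite PoszD !PoszM; ring.
Qed.

Let u (m : 'I_(\dim {:F})) := basis_elt m.

Let u_neq0 : 'I_s -> forall m, u m != 0.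
Proof. by move=> l m; have [] := basis_elt_value l m. Qed.

Let u_distinct l m m' : ((\dim {:F})%:Z %| v l (u m) - v l (u m'))%Z -> m = m'.
Proof.
have [_ ->] := basis_elt_value l m; have [_ ->] := basis_elt_value l m'.
rewrite opprK addrC -eqz_mod_dvd !modz_nat => /eqP[e].
have mN (i : 'I_(\dim {:F})) : (i < p ^ n)%N by rewrite -dimF.
apply/val_inj/(pole_order_inj p_gt0 (@lambda_coprime l) (mN m) (mN m')).
by rewrite -dimF.
Qed.

Lemma trace_dual m m' : (m < p ^ n)%N -> (m' < p ^ n)%N ->
  galTrace 1%AS {:F} (basis_elt m * dual_elt m') = if m == m' then (-1) ^+ n else 0.
Proof.
move=> mN m'N; have [L0 Ln Lstep] := Ltower.
rewrite /basis_elt /dual_elt -big_split -L0 /=.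
rewrite (tower_trace_dual charF galF Ln Lstep Ly (a := digit p m) (d := digit p m')) //.
  case: eqVneq => [->|mm'].
    rewrite (eq_bigr (fun=> -1)) => [|j _]; last by rewrite eqxx.
    by rewrite prodr_const_nat subn1.
  have [/forallP digit_eq|/forallPn[j]] :=
      boolP [forall j : 'I_n.+1, (0 < j)%N ==> (digit p m j == digit p m' j)].
    case/eqP: mm'; apply: (digit_inj p_gt0 mN m'N) => j /andP[j1 jn].
    by have /implyP/(_ j1)/eqP := digit_eq (Ordinal (jn : (j < n.+1)%N)).
  rewrite negb_imply => /andP[j1 /negPf jd]; apply/eqP; rewrite prodf_seq_eq0.
  by apply/hasP; exists (val j); rewrite ?mem_index_iota ?j1 ?ltn_ord //= jd oppr0 eqxx.
by move=> i; rewrite !digit_lt.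
Qed.

Lemma galTraceM (c z : F) : c \in 1%VS ->
  galTrace 1%AS {:F} (c * z) = c * galTrace 1%AS {:F} z.
Proof.
move=> Kc; rewrite /galTrace mulr_sumr; apply: eq_bigr => g _.
by rewrite rmorphM /= gal_fix1.
Qed.

Lemma coef_trace (c : 'I_(\dim {:F}) -> F) m : (forall i, c i \in 1%VS) ->
  c m = (-1) ^+ n * galTrace 1%AS {:F} ((\sum_i c i * u i) * dual_elt m).
Proof.
move=> Kc; have mN (i : 'I_(\dim {:F})) : (i < p ^ n)%N by rewrite -dimF.
rewrite mulr_suml raddf_sum (bigD1 m) //= big1 => [|i /negPf im].
  by rewrite -mulrA galTraceM // trace_dual // eqxx addr0 mulrCA -expr2 sqrr_sign mulr1.
by rewrite -mulrA galTraceM // trace_dual // (im : (i == m :> nat) = false) mulr0.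
Qed.

(** Away from the ramified points the right-hand side B_j has no pole.  The
    standard form speaks of places of L_(j-1), hence the restriction of R. *)
Lemma generator_regular (R : F -> int) : is_place {:F} R ->
  (forall l, R (x_ (alpha l)) <= 0) ->
  forall j, (1 <= j <= n)%N -> vge R 0 (y j).
Proof.
move=> PR Ralpha j jn; have [defL BL yB] := Ly jn.
apply: (artin_schreier_integral PR p_prime _ _ yB); rewrite ?memvf //.
have [e [Q [e0 QP RQ]]] := place_restriction PR (L j.-1).
have [_ _ _ reg] := standard jn.
rewrite /vge RQ // mulr_ge0 ?orbT // reg // => l QE.
have := Ralpha l; rewrite RQ ?poly_in_mem // QE.
have j1 : (j.-1 <= n)%N by lia.
have [_ over] := Pplace l j1.
have : 0 < P l j.-1 (x_ (alpha l)).
  apply: over; first exact: (poly_in_mem _ 1%AS).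
  by rewrite (proj2 (Palpha l)) ?polyXsubC_eq0 // -['X - _]expr1 mup_XsubCX eqxx.
by rewrite /x_; gen_vals (P l j.-1); nia.
Qed.

(** The coefficient is a sum of conjugates of f times a dual basis element.
    A conjugate of R is again not above any alpha_l, so it differs from the
    only pole of f. *)
Lemma coef_regular i a f (c : 'I_(\dim {:F}) -> F) (R : F -> int) :
  has_pole_divisor (v i) a f -> is_place {:F} R ->
  (forall l, R (x_ (alpha l)) <= 0) ->
  (forall m, c m \in 1%VS) -> f = \sum_m c m * u m -> forall m, vge R 0 (c m).
Proof.
move=> [_ freg] PR Ralpha Kc fE m; rewrite (coef_trace m Kc) -fE.
rewrite -[0]addr0 (vgeM PR) ?memvf //.
  by rewrite /vge (placeX PR) ?memvf ?oppr_eq0 ?oner_neq0 // (placeN PR) ?memvf // (place1 PR) mulr0 orbT.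
apply: (vge_sum PR) => [g _|g _]; first exact: memvf.
have Px := gal_place g PR; have galpha l : (R \o g) (x_ (alpha l)) <= 0.
  by rewrite /= gal_fix1 // (poly_in_mem _ 1%AS).
have vgeg z : vge R 0 (g z) = vge (R \o g) 0 z by rewrite /vge fmorph_eq0.
rewrite vgeg -[0]addr0 (vgeM Px) ?memvf //.
  rewrite /vge freg ?orbT // => gv; have := galpha i; rewrite gv.
  by rewrite x_value eqxx muln1; have := N_gt0; rewrite /N; clear; lia.
rewrite /dual_elt big_seq; apply: (vge_prod Px) => j; first by rewrite memvf.
rewrite mem_index_iota ltnS => jn; rewrite (vgeB Px) ?memvf ?(vgeX Px) ?memvf //.
  exact: generator_regular.
by rewrite -(rmorph_nat (const_in F)) (vge_const Px).
Qed.

(** The least order at alpha_l of a rational function c such that c w_m is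
    regular at P_l, that is, the ceiling of the pole order of w_m divided by
    p ^ n. *)
Definition ceil_order l m := ((mu l m + (p ^ n).-1) %/ p ^ n)%N.

Lemma ceil_orderP l m (q : int) :
  (mu l m)%:Z <= (p ^ n)%N%:Z * q -> (ceil_order l m)%:Z <= q.
Proof.
have := N_gt0; rewrite /ceil_order /N; move: (p ^ n)%N (mu l m) => M r M0 rq.
have q0 : 0 <= q by nia.
case: q q0 rq => // q _ rq; rewrite lez_nat -ltnS ltn_divLR //; nia.
Qed.

Lemma le_ceil_order l m : ((mu l m) <= p ^ n * ceil_order l m)%N.
Proof.
have := N_gt0; rewrite /ceil_order /N; move: (p ^ n)%N (mu l m) => M r M0.
by have := divn_eq (r + M.-1) M; have := ltn_pmod (r + M.-1) M0; nia.
Qed.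

Lemma ram_place_eq l (R : F -> int) : is_place {:F} R -> 0 < R (x_ (alpha l)) -> R = v l.
Proof.
move=> PR Rl; apply: (totally_ramified_unique (PQ l) (Pv l) (@vQ l)) => // z Kz.
have [q [d [d0 ->]]] := mem1_quotient Kz.
have [->|q0] := eqVneq q 0; first by rewrite rmorph0 mul0r (place0 (PQ l)).
rewrite (place_div (PQ l)) ?poly_in_mem ?poly_in_eq0 //.
rewrite (place_div PR) ?memvf ?poly_in_eq0 //.
rewrite (place_at_finite PR Rl q0) (place_at_finite PR Rl d0) !(proj2 (Palpha l)) // -mulrBr.
by move=> h; rewrite pmulr_rgt0.
Qed.

(** The function w_m times the product of the (x - alpha_l) ^ e_l, where
    e_l = ceil(mu_l(m) / N) cancels the pole at P_l and e_i = - t gives the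
    pole of order a.  It is regular at infinity because the e_l sum to at most
    zero. *)
Lemma pole_number_construct i m (t : int) (a : nat) :
  a%:Z = (mu i m)%:Z + (p ^ n)%N%:Z * t ->
  (\sum_(l | l != i) ceil_order l m)%N%:Z <= t ->
  exists f, has_pole_divisor (v i) a f.
Proof.
move=> aE le_t.
pose e l : int := if l == i then - t else (ceil_order l m)%:Z.
have x0 b : x_ b != 0 by rewrite poly_in_eq0 polyXsubC_eq0.
have esum : \sum_l e l <= 0.
  rewrite (bigD1 i) //= {1}/e eqxx addrC subr_le0.
  rewrite (eq_bigr (fun l => (ceil_order l m)%:Z)) => [|l /negPf li]; last by rewrite /e li.
  by rewrite -(big_morph Posz PoszD (erefl 0%:Z)).
pose g := \prod_l x_ (alpha l) ^ e l.
have g0 : g != 0 by apply/prodf_neq0 => l _; rewrite expfz_neq0.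
have gval (R : F -> int) : is_place {:F} R -> R g = \sum_l e l * R (x_ (alpha l)).
  move=> PR; have : g != 0 /\ R g = \sum_l e l * R (x_ (alpha l)); last by case.
  rewrite /g; elim/big_ind2: _ => [|? ? ? ? [h0 <-] [h0' <-]|l _].
  - by rewrite oner_neq0 (place1 PR).
  - by rewrite mulf_neq0 // (placeM PR) ?memvf.
  - by rewrite expfz_neq0 // (placeZ PR) ?memvf.
have vg l : v l g = (p ^ n)%N%:Z * e l.
  rewrite gval // (bigD1 l) //= big1 => [|l' /negPf ll'].
    by rewrite x_value eqxx muln1 addr0 mulrC.
  by rewrite x_value (inj_eq alpha_inj) ll' muln0 mulr0.
have vw l : v l (g * basis_elt m) = (p ^ n)%N%:Z * e l - (mu l m)%:Z.
  by have [w0 wv] := basis_elt_value l m; rewrite (placeM (Pv l)) ?memvf // vg wv.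
exists (g * basis_elt m); split; first by rewrite vw /e eqxx aE; ring.
have [w0 _] := basis_elt_value i m.
move=> R PR Ri; rewrite -(vgeE R _ (mulf_neq0 g0 w0)).
have [/existsP[l Rl]|/existsPn Rl] := boolP [exists l, 0 < R (x_ (alpha l))].
  have RE := ram_place_eq PR Rl; rewrite RE in Ri *.
  have li : l != i by apply: contra_notN Ri => /eqP ->.
  rewrite /vge vw /e (negPf li) subr_ge0 -PoszM lez_nat le_ceil_order orbT //.
have {}Rl l : R (x_ (alpha l)) <= 0 by have := Rl l; rewrite -leNgt.
rewrite -[0]addr0 (vgeM PR) ?memvf //; last first.
  rewrite /basis_elt big_seq; apply: (vge_prod PR) => j; first by rewrite memvf.
  rewrite mem_index_iota ltnS => jn; rewrite (vgeX PR) ?memvf //.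
  exact: generator_regular.
rewrite /vge gval //; apply/orP; right.
have [RX|RX] := ltP (R (poly_in F 'X)) 0.
  rewrite (eq_bigr (fun l => e l * R (poly_in F 'X))) => [|l _].
    by rewrite -mulr_suml mulr_le0 // ltW.
  by rewrite /x_ (place_at_infinity PR RX) ?polyXsubC_eq0 // size_XsubC mul1r.
rewrite big1 // => l _; suff -> : R (x_ (alpha l)) = 0 by rewrite mulr0.
apply/eqP; rewrite eq_le Rl /= -(vgeE R _ (x0 _)) (vge_poly_in PR) //.
by rewrite /vge RX orbT.
Qed.

(** The term c_m w_m of least value at P_i carries the pole of f, and inherits
    all regularity conditions from f: at the other P_l because the value there
    is also a minimum over terms, elsewhere by [coef_regular].  It then
    suffices to compare degrees. *)
Lemma pole_number_bound g i f (a : nat) : genus F g -> (0 < a)%N ->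
  has_pole_divisor (v i) a f ->
  exists m (t : int), [/\ (m < p ^ n)%N, a%:Z = (mu i m)%:Z + (p ^ n)%N%:Z * t
   & (\sum_(l | l != i) ceil_order l m)%N%:Z <= t].
Proof.
move=> gF a0 fa; have [vf freg] := fa.
have f0 : f != 0.
  by apply: contra_eq_neq vf => ->; rewrite (place0 (Pv i)); lia.
have [c Kc fE] := val_basis (Pv i) (@vQ i) (u_neq0 i) (@u_distinct i) f.
have [c0|[m [cm0 s0 sv smin]]] := val_comb (Pv i) (@vQ i) (u_neq0 i) (@u_distinct i) Kc.
  by case/eqP: f0; rewrite fE big1 // => m _; rewrite c0 mul0r.
rewrite -fE in s0 sv smin.
have [q [d [d0 cE]]] := mem1_quotient (Kc m).
have q0 : q != 0 by apply: contraNneq cm0 => q0; rewrite cE q0 rmorph0 mul0r.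
have Qc l : P l 0%N (c m) = (mup (alpha l) q)%:Z - (mup (alpha l) d)%:Z.
  by rewrite cE (place_div (PQ l)) ?poly_in_mem ?poly_in_eq0 // !(proj2 (Palpha l)).
exists m, (- P i 0%N (c m)); split; first by rewrite -dimF.
  have [_ wv] := basis_elt_value i m.
  by move: sv; rewrite vf wv dimZ; clear; lia.
pose e l : int := if l == i then P i 0%N (c m) else (ceil_order l m)%:Z.
suff : \sum_l e l <= 0.
  rewrite (bigD1 i) //= {1}/e eqxx.
  rewrite (eq_bigr (fun l => (ceil_order l m)%:Z)) => [|l /negPf li]; last by rewrite /e li.
  by rewrite -(big_morph Posz PoszD (erefl 0%:Z)) addrC -[- _]add0r lerBrDr.
have ratv : rational_place (v i).
  split; first exact: Pv.
  exact: (residue_const (PQ i) (Pv i) (@vQ i) (proj2 (Palpha i))).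
have poly_nonconst (r : {poly k}) : (1 < size r)%N -> forall b, poly_in F r <> const_in F b.
  move=> sr b /eqP; rewrite -subr_eq0 [const_in F b]/(poly_in F b%:P) -rmorphB poly_in_eq0.
  rewrite subr_eq0 => /eqP rb; move: sr; rewrite rb ltnNge.
  by rewrite size_polyC_leq1.
have Rc R : is_place {:F} R -> (forall l, R (x_ (alpha l)) <= 0) ->
    R (poly_in F d) <= R (poly_in F q).
  move=> PR Rl; have := coef_regular fa PR Rl Kc fE m; rewrite vgeE // cE.
  by rewrite (place_div PR) ?memvf ?poly_in_eq0 // subr_ge0.
(* the orders of c_m at the alpha_l, at the other points, and at infinity *)
apply: (regular_function_degree alpha_inj q0 d0).
- move=> l; rewrite -Qc /e; case: eqVneq => [-> //|li].
  apply: ceil_orderP; have [w0 wv] := basis_elt_value l m.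
  have vl_vi : v l <> v i.
    move=> vli; have := x_value l (alpha l); rewrite vli x_value eqxx (inj_eq alpha_inj).
    rewrite (negPf li) muln0 muln1 => /esym/eqP.
    by rewrite eqz_nat eqn0Ngt -/N N_gt0.
  have := freg _ (Pv l) vl_vi => vlf.
  have [cl0|[m' [cm'0 s'0 s'v s'min]]] := val_comb (Pv l) (@vQ l) (u_neq0 l) (@u_distinct l) Kc.
    by rewrite cl0 eqxx in cm0.
  have := s'min m; rewrite -fE vgeE ?mulf_neq0 // (placeM (Pv l)) ?memvf // wv (vQ l (Kc m)) dimZ.
  by move: vlf; gen_vals (v l); clear; lia.
- move=> b nb; have [|R PR Rb] := @nonconstant_zero _ _ g _ (x_ b) gF ratv.
    by apply: poly_nonconst; rewrite size_XsubC.
  have := Rc R PR; rewrite (place_at_finite PR Rb q0) (place_at_finite PR Rb d0) ler_pM2l // lez_nat; apply=> l.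
  rewrite /x_ (place_at_finite PR Rb) ?polyXsubC_eq0 //.
  rewrite -['X - (alpha l)%:P]expr1 mup_XsubCX.
  by case: eqP => [/esym/nb //|]; rewrite mulr0.
- have [|R PR] := @nonconstant_zero _ _ g _ (poly_in F 'X)^-1 gF ratv.
    move=> b /(congr1 (fun z => z^-1)); rewrite invrK -fmorphV.
    by apply: poly_nonconst; rewrite size_polyX.
  rewrite (placeV PR) ?memvf // oppr_gt0 => RX.
  have := Rc R PR; rewrite (place_at_infinity PR RX q0) (place_at_infinity PR RX d0) ler_nM2r // lez_nat => h.
  have : ((size q).-1 <= (size d).-1)%N.
    apply: h => l; rewrite /x_ (place_at_infinity PR RX) ?polyXsubC_eq0 //.
    by rewrite size_XsubC mul1r ltW.
  by rewrite -ltnS !prednK ?size_poly_gt0.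
Qed.

(** Up to sign the trace of z is its coefficient c at the last basis element,
    which is integral as soon as z has value at least - mu_l(N-1) - (N-1),
    values of c being multiples of N.  This bound is attained by the
    complementary module: below it, some integral multiple of z is the last
    basis element divided by a uniformizer of the base. *)
Lemma different_exponentE l (d : int) : different_exponent 1%AS (P l 0%N) (v l) d ->
  d = (mu l (p ^ n).-1 + (p ^ n).-1)%N%:Z.
Proof.
pose M := (mu l (p ^ n).-1 + (p ^ n).-1)%N; rewrite -/M.
have int_vge := int_closure_vge (PQ l) (Pv l) (@vQ l) galF.
have topM : ((p ^ n).-1 < p ^ n)%N by rewrite ltn_predL N_gt0.
have topN : ((p ^ n).-1 < \dim {:F})%N by rewrite dimF.
pose top := Ordinal topN.
have [w0 wv] := basis_elt_value l (p ^ n).-1.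
have dual_top : dual_elt (p ^ n).-1 = 1.
  rewrite /dual_elt big_nat big1 // => j jn.
  rewrite -[(p ^ n).-1]subn0 digit_compl ?N_gt0 //.
  rewrite /digit div0n mod0n subn0 subnn expr0.
  by rewrite (gtn_eqF (_ : 0 < p.-1)%N) ?subr0 // -subn1 subn_gt0 prime_gt1.
have trace_top z : exists2 c, c \in 1%VS & galTrace 1%AS {:F} z = (-1) ^+ n * c /\
    (forall b : int, vge (v l) b z -> vge (v l) b (c * basis_elt (p ^ n).-1)).
  have [c Kc zE] := val_basis (Pv l) (@vQ l) (u_neq0 l) (@u_distinct l) z.
  exists (c top); first exact: Kc.
  split=> [|b zb].
    rewrite (coef_trace top Kc) -zE dual_top mulr1 mulrA -expr2 sqrr_sign mul1r //.
  have [c0|[m' [cm'0 s'0 s'v s'min]]] := val_comb (Pv l) (@vQ l) (u_neq0 l) (@u_distinct l) Kc.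
    by rewrite c0 mul0r vge0.
  by apply: vge_le (s'min top); rewrite -zE -(vgeE (v l)) // zE.
have signE (c : F) : c \in 1%VS -> ((-1) ^+ n * c \in val_ring 1%AS (P l 0%N)) = vge (v l) 0 c.
  move=> Kc; have sK : (-1) ^+ n * c \in (1%VS : {vspace F}).
    by rewrite -signr_odd; case: (odd n); rewrite ?expr1 ?expr0 ?mul1r // mulN1r rpredN.
  rewrite inE sK /= (vge_base (@vQ l)) // /vge.
  have -> : P l 0%N ((-1) ^+ n * c) = P l 0%N c.
    by rewrite -signr_odd; case: (odd n); rewrite ?expr1 ?expr0 ?mul1r // mulN1r (placeN (PQ l)).
  by case: eqP => [->|//]; rewrite (place0 (PQ l)).
(* the complementary module consists of the z of value at least - M *)
have compl z : compl_module 1%AS (P l 0%N) z <-> vge (v l) (- M%:Z) z.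
  split=> [zc|zM r /int_vge vr].
    apply/negPn/negP; rewrite /vge negb_or -ltNge => /andP[z0 vz].
    have [b Kb Qb] := place_onto (PQ l).
    have b0 : b != 0 by apply: contra_eqN Qb => /eqP ->; rewrite (place0 (PQ l)).
    have vb : v l b = (p ^ n)%N%:Z by rewrite vQ // Qb dimF mulr1.
    have := zc (basis_elt (p ^ n).-1 / (b * z)).
    have -> : z * (basis_elt (p ^ n).-1 / (b * z)) = b^-1 * (basis_elt (p ^ n).-1 * dual_elt (p ^ n).-1).
      by rewrite dual_top; field; rewrite b0 z0.
    rewrite galTraceM ?rpredV // trace_dual // eqxx [b^-1 * _]mulrC => h.
    have : vge (v l) 0 b^-1.
      rewrite -signE ?rpredV //; apply: h; apply/int_vge.
      rewrite vgeE ?mulf_neq0 ?invr_eq0 ?mulf_neq0 //.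
      rewrite (place_div (Pv l)) ?memvf ?mulf_neq0 // (placeM (Pv l)) ?memvf // wv vb.
      by move: vz; rewrite /M; have := N_gt0; rewrite /N; clear; lia.
    by rewrite vgeE ?invr_eq0 // (placeV (Pv l)) ?memvf // vb; have := N_gt0; rewrite /N; clear; lia.
  have [c Kc [trE cE]] := trace_top (z * r); rewrite trE signE //.
  have : vge (v l) (- M%:Z) (c * basis_elt (p ^ n).-1).
    by apply: cE; rewrite -[- _]addr0 (vgeM (Pv l)) ?memvf.
  rewrite (vge_base (@vQ l)) //; have [->|c0] := eqVneq c 0; first by rewrite !vge0.
  rewrite !vgeE ?mulf_neq0 // (placeM (Pv l)) ?memvf // wv vQ // dimZ /M.
  by have := N_gt0; rewrite /N; clear; nia.
case=> t [tP ->]; have [z _ vz] := place_onto (Pv l).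
have z0 : z != 0 by apply: contra_eqN vz => /eqP ->; rewrite (place0 (Pv l)).
pose z' := z ^ (- M%:Z); have z'0 : z' != 0 by rewrite expfz_neq0.
have vz' : v l z' = - M%:Z by rewrite (placeZ (Pv l)) ?memvf // vz mulr1.
have [r /int_vge vr z'E] : exists2 r, int_closure 1%AS (P l 0%N) r & z' = t * r.
  by apply/tP/compl; rewrite vgeE // vz'.
have t0 : t != 0 by apply: contraNneq z'0 => t0; rewrite z'E t0 mul0r.
have r0 : r != 0 by apply: contraNneq z'0 => r0; rewrite z'E r0 mulr0.
have : vge (v l) (- M%:Z) t.
  apply/compl/tP; exists 1; rewrite ?mulr1 //; apply/int_vge.
  by rewrite /vge (place1 (Pv l)) orbT.
move: vr; rewrite !vgeE // => vr vt.
by move: vz'; rewrite z'E (placeM (Pv l)) ?memvf //; move: vr vt; gen_vals (v l); clear; lia.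
Qed.

End PoleNumbers.

(** * Boseck invariants and gaps *)

Section BoseckArithmetic.

Variables (p n s : nat) (delta : 'I_s -> int) (lambda : 'I_s -> nat -> nat).
Hypothesis p_gt0 : (0 < p)%N.
Hypothesis delta_eq : forall l,
  delta l = (pole_order p (lambda l) n (p ^ n).-1 + (p ^ n).-1)%N%:Z.

Let M := (p ^ n)%N.
Let M_gt0 : (0 < M)%N. Proof. by rewrite expn_gt0 p_gt0. Qed.

Lemma boseck_rho_ge0 l m : 0 <= boseck_rho p n delta lambda l m.
Proof. by apply: modz_ge0; rewrite eqz_nat -lt0n. Qed.

(** The different exponent is the pole order for p ^ n - 1 plus p ^ n - 1, and
    complementary indices have complementary digits. *)
Lemma boseck_num_compl l m : (m < p ^ n)%N ->
  boseck_num p n delta lambda l ((p ^ n).-1 - m) =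
  (pole_order p (lambda l) n m + (p ^ n).-1)%N%:Z.
Proof.
move=> mM; rewrite /boseck_num delta_eq -/(pole_order p (lambda l) n _).
by have := pole_order_compl p_gt0 (lambda l) mM; lia.
Qed.

Lemma boseck_nu_compl l m : (m < p ^ n)%N ->
  boseck_nu p n delta lambda l ((p ^ n).-1 - m) = (ceil_order p n lambda l m)%:Z.
Proof. by move=> mM; rewrite /boseck_nu boseck_num_compl // divz_nat. Qed.

Lemma boseck_Gamma_compl m : (m < p ^ n)%N ->
  boseck_Gamma p n delta lambda ((p ^ n).-1 - m) =
  (\sum_l ceil_order p n lambda l m)%N%:Z.
Proof.
move=> mM; rewrite /boseck_Gamma (big_morph Posz PoszD (erefl 0%:Z)).
by apply: eq_bigr => l _; rewrite boseck_nu_compl.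
Qed.

(** With c the ceiling of mu_i(m) / N, the two parametrizations of the residue
    class of mu_i(m) are related by t = nu + 1 - c.  The condition nu >= 0 is
    the positivity of a, and nu <= Gamma - 2 is the failure of the criterion for
    pole numbers. *)
Lemma boseck_progression i (a m : nat) (t : int) : (m < p ^ n)%N -> (0 < a)%N ->
  a%:Z = (pole_order p (lambda i) n m)%:Z + (p ^ n)%N%:Z * t ->
  (exists nu : nat,
    nu%:Z <= boseck_Gamma p n delta lambda ((p ^ n).-1 - m) - 2 /\
    a%:Z = nu%:Z * (p ^ n)%N%:Z + boseck_rho p n delta lambda i ((p ^ n).-1 - m) + 1)
  <-> t < (\sum_(l | l != i) ceil_order p n lambda l m)%N%:Z.
Proof.
move=> mM a0 aE; rewrite /boseck_rho boseck_Gamma_compl // boseck_nu_compl // boseck_num_compl //.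
rewrite (bigD1 i) //=; set S := (\sum_(l < s | l != i) _)%N.
have := divn_eq (pole_order p (lambda i) n m + (p ^ n).-1) (p ^ n).
have := ltn_pmod (pole_order p (lambda i) n m + (p ^ n).-1) M_gt0.
move: M_gt0 aE; rewrite -/(ceil_order p n lambda i m) /M.
move: (p ^ n)%N (pole_order p (lambda i) n m) (ceil_order p n lambda i m) {mM} => q r c.
move: (_ %% q)%N => r' q0 aE r'q divE.
have qE : q%:Z = q.-1%:Z + 1 by lia.
split=> [[nu [nu_le aE']]|tS].
  have : q%:Z * (t - (nu%:Z + 1 - c%:Z)) = 0 by lia.
  by move/eqP; rewrite mulf_eq0 => /orP[]; lia.
have t_ge : 0 < t + c%:Z.
  have : 0 < q%:Z * (t + c%:Z) by lia.
  by rewrite pmulr_rgt0 //; lia.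
exists (absz (t + c%:Z - 1)%R); split; first by lia.
by rewrite gez0_abs; lia.
Qed.

End BoseckArithmetic.

Local Open Scope classical_set_scope.
Local Open Scope ring_scope.

Theorem proposition38
  (k : closedFieldType) (p : nat) (char_k : p \in [pchar k])
  (F : splittingFieldType {fraction {poly k}}) (n : nat)
  (F_galois : galois 1%AS {:F}%AS)
  (F_cyclic : cyclic 'Gal({:F}%AS / 1%AS)%g)
  (F_degree : \dim {:F} = (p ^ n)%N)
  (g : nat) (F_genus : genus F g) (g_ge2 : (2 <= g)%N)
  (s : nat) (alpha : 'I_s -> k) (alpha_inj : injective alpha)
  (ramified_places : forall Q : F -> int, is_place 1%AS Q ->
     (ramified 1%AS Q <-> exists i : 'I_s, place_at (alpha i) Q))
  (ramified_total : forall Q : F -> int, is_place 1%AS Q ->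
     ramified 1%AS Q -> totally_ramified 1%AS Q)
  (L : nat -> {subfield F}) (L_tower : is_tower p n L)
  (P : 'I_s -> nat -> F -> int) (P_above : places_above n alpha L P)
  (y B : nat -> F) (lambda : 'I_s -> nat -> nat)
  (standard : standard_form p n L P y B lambda)
  (delta : 'I_s -> int)
  (delta_different : forall i : 'I_s,
     different_exponent 1%AS (P i 0%N) (P i n) (delta i))
  (i : 'I_s) :
  gaps (P i n) =
  [set a : nat | exists m nu : nat,
     [/\ (m%:Z <= (p ^ n)%N%:Z - 2),
         (nu%:Z <= boseck_Gamma p n delta lambda m - 2)
       & a%:Z = nu%:Z * (p ^ n)%N%:Z + boseck_rho p n delta lambda i m + 1]].
Proof.
have char_F : p \in [pchar F] by exact: (rmorph_pchar (const_in F) char_k).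
have p_prime := pcharf_prime char_k; have p_gt0 := prime_gt0 p_prime.
have M_gt0 : (0 < p ^ n)%N by rewrite expn_gt0 p_gt0.
have P_total l : totally_ramified 1%AS (P l 0%N).
  have [[Pl Pl_alpha] _] := P_above l; apply: ramified_total => //.
  by apply/ramified_places => //; exists l.
have delta_eq l := different_exponentE char_F F_galois F_degree L_tower
  P_above P_total standard (delta_different l).
have lam_cop := @lambda_coprime _ _ _ _ _ _ _ _ _ _ _ char_F F_galois F_degree
  L_tower P_above P_total standard i.
have mod_mu m (t : int) (a : nat) :
    a%:Z = (pole_order p (lambda i) n m)%:Z + (p ^ n)%N%:Z * t ->
    pole_order p (lambda i) n m = a %[mod p ^ n].
  move=> aE; suff : (pole_order p (lambda i) n m = a %[mod (p ^ n)%N])%Z.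
    by rewrite !modz_nat => -[].
  by rewrite aE addrC mulrC modzMDl.
apply/seteqP; split=> a /=.
  case=> a0 no_f; have [m mM ma] := pole_order_surj p_gt0 a lam_cop.
  have [t aE] : exists t : int, a%:Z = (pole_order p (lambda i) n m)%:Z + (p ^ n)%N%:Z * t.
    have : ((p ^ n)%N%:Z %| a%:Z - (pole_order p (lambda i) n m)%:Z)%Z.
      by rewrite -eqz_mod_dvd !modz_nat ma.
    by case/dvdzP=> t tE; exists t; rewrite mulrC -tE addrC subrK.
  have tS : t < (\sum_(l | l != i) ceil_order p n lambda l m)%N%:Z.
    rewrite ltNge; apply/negP => le_t; apply: no_f.
    exact: (pole_number_construct char_F F_galois F_degree alpha_inj L_tower
      P_above P_total standard aE le_t).
  (* for m = 0 all the ceilings vanish, and every positive multiple of p ^ n is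
     a pole number *)
  have m0 : (0 < m)%N.
    rewrite lt0n; apply: contraTneq tS => m0; rewrite -leNgt big1 => [|l _].
      by move: aE; rewrite m0 pole_order0; move: M_gt0 a0; clear; nia.
    by rewrite /ceil_order m0 pole_order0 divn_small // ltn_predL.
  have [nu [nu_le aE']] := proj2 (boseck_progression p_gt0 delta_eq mM a0 aE) tS.
  exists ((p ^ n).-1 - m)%N, nu; split=> //.
  by move: M_gt0 mM m0; clear; lia.
case=> m' [nu [m'M nu_le aE']].
have [m mM m'E] : exists2 m, (m < p ^ n)%N & m' = ((p ^ n).-1 - m)%N.
  by exists ((p ^ n).-1 - m')%N; move: M_gt0 m'M; clear; lia.
rewrite {}m'E {m'M} in nu_le aE'.
pose t : int := nu%:Z + 1 - (ceil_order p n lambda i m)%:Z.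
have aE : a%:Z = (pole_order p (lambda i) n m)%:Z + (p ^ n)%N%:Z * t.
  rewrite aE' /boseck_rho boseck_nu_compl // boseck_num_compl // /t.
  by move: M_gt0; clear; nia.
have a0 : (0 < a)%N.
  rewrite -ltz_nat aE'; have := boseck_rho_ge0 n delta lambda p_gt0 i ((p ^ n).-1 - m).
  by move: (boseck_rho _ _ _ _ _ _) M_gt0 => rho; clear; nia.
have tS := proj1 (boseck_progression p_gt0 delta_eq mM a0 aE)
  (ex_intro _ nu (conj nu_le aE')).
split=> // -[f fa].
have [m2 [t2 [m2M aE2 le_t2]]] := pole_number_bound char_F F_galois F_degree
  alpha_inj L_tower P_above P_total standard F_genus a0 fa.
have mm2 : m = m2.
  apply: (pole_order_inj p_gt0 lam_cop mM m2M).
  by rewrite (mod_mu _ _ _ aE) (mod_mu _ _ _ aE2).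
move: tS; rewrite ltNge => /negP; apply; rewrite mm2.
suff -> : t = t2 by [].
move: aE; rewrite aE2 -mm2 => /addrI/mulfI -> //.
by rewrite eqz_nat -lt0n.
Qed.
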